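(* Let $n\ge 2$ and let $H$ be a graph with vertex set $[n]$. The following are equivalent: (1) $H$ is Laman; (2) $H$ is Henneberg; (3) there exist rooted binary trees $T_1,T_2$ on leaf set $[n]$ such that the restricted clade graph $G^H_{T_1,T_2}$ is a tree; (4) $H$ is generically minimally rigid in the plane $\mathbb{R}^2$.
   Context: A graph $H$ on $n$ vertices is Laman if it has $2n-3$ edges and every subgraph of $H$ with $v\ge 2$ vertices has at most $2v-3$ edges. A graph is Henneberg if it is the complete graph $K_2$, or it can be obtained from a smaller Henneberg graph by one of the two Henneberg moves: (i) adding a new vertex adjacent to two existing vertices; (ii) removing an existing edge $ij$ and adding a new vertex adjacent to $i$, $j$ and one other existing vertex. A rooted tree on leaf set $[n]$ has leaves labeled bijectively by $[n]$ and each internal vertex has at least two children; it is binary if each internal vertex has exactly two children. A clade of $T$ is the set of leaves below an internal vertex; $\mathrm{clade}(T)$ is the set of clades. For $S\subseteq[n]$, $c_T(S)$ is the smallest clade of $T$ containing $S$. The restricted clade graph $G^H_{T_1,T_2}$ is the bipartite multigraph whose vertex set is the disjoint union of $\mathrm{clade}(T_1)$ and $\mathrm{clade}(T_2)$ and which has, for each edge $ij$ of $H$, one edge $e_{ij}$ joining $c_{T_1}(\{i,j\})$ to $c_{T_2}(\{i,j\})$. A bar-and-joint framework $(V,E,\mathbf p)$ with $\mathbf p:V\to\mathbb{R}^d$ injective is rigid if there is $\varepsilon>0$ such that every injective $\mathbf q:V\to\mathbb{R}^d$ with $\sum_{u\in V}\|\mathbf p(u)-\mathbf q(u)\|^2\le\varepsilon$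 and $\|\mathbf q(u)-\mathbf q(v)\|=\|\mathbf p(u)-\mathbf p(v)\|$ for all $uv\in E$ has image related to the image of $\mathbf p$ by a Euclidean isometry. A graph $(V,E)$ is generically rigid in $\mathbb{R}^d$ if $(V,E,\mathbf p)$ is rigid for generic $\mathbf p$; it is generically minimally rigid if it is generically rigid and deleting any edge yields a graph that is not generically rigid. *)

(* Defs.v *)
From HB Require Import structures.
From mathcomp Require Import all_boot all_order all_algebra.
From mathcomp Require Import reals.
From mathcomp Require Import mpoly.
Set Implicit Arguments.
Unset Strict Implicit.
Unset Printing Implicit Defensive.
Import Order.TTheory GRing.Theory Num.Theory.

Definition simple_graph (T : finType) (E : {set {set T}}) : Prop :=
  forall e, e \in E -> #|e| = 2%N.

Definition laman (n : nat) (E : {set {set 'I_n}}) : Prop :=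
  #|E| = (2 * n - 3)%N /\
  forall (S : {set 'I_n}) (F : {set {set 'I_n}}),
    (2 <= #|S|)%N -> F \subset E -> (forall e, e \in F -> e \subset S) ->
    (#|F| <= 2 * #|S| - 3)%N.

Inductive henneberg (T : finType) : {set T} -> {set {set T}} -> Prop :=
| Henneberg_K2 (a b : T) :
    a != b -> henneberg [set a; b] [set [set a; b]]
| Henneberg_move1 (V : {set T}) (E : {set {set T}}) (x a b : T) :
    henneberg V E -> x \notin V -> a \in V -> b \in V -> a != b ->
    henneberg (x |: V) ([set [set x; a]; [set x; b]] :|: E)
| Henneberg_move2 (V : {set T}) (E : {set {set T}}) (x i j k : T) :
    henneberg V E -> x \notin V -> [set i; j] \in E ->
    k \in V -> k != i -> k != j ->
    henneberg (x |: V)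
      ([set [set x; i]; [set x; j]; [set x; k]] :|: (E :\ [set i; j])).

Definition henneberg_graph (n : nat) (E : {set {set 'I_n}}) : Prop :=
  henneberg [set: 'I_n] E.

Inductive btree (T : Type) : Type :=
| BLeaf of T
| BNode of btree T & btree T.
Arguments BLeaf {T}.
Arguments BNode {T}.

Fixpoint leaves (T : Type) (t : btree T) : seq T :=
  match t with
  | BLeaf x => [:: x]
  | BNode l r => leaves l ++ leaves r
  end.

Definition binary_tree_on (n : nat) (t : btree 'I_n) : Prop :=
  perm_eq (leaves t) (enum 'I_n).

Fixpoint clades (n : nat) (t : btree 'I_n) : seq {set 'I_n} :=
  match t with
  | BLeaf _ => [::]
  | BNode l r => [set x in leaves t] :: (clades l ++ clades r)
  end.

Definition smallest_clade (n : nat) (t : btree 'I_n) (S c : {set 'I_n}) : Prop :=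
  c \in clades t /\ S \subset c /\
  forall c', c' \in clades t -> S \subset c' -> c \subset c'.

(* Multigraphs: vertex set [vs], edge set [es], incidence [inc e x y]      *)
(* meaning that edge e has endpoints x and y.                             *)
Definition mg_link (V Ed : Type) (inc : Ed -> V -> V -> Prop) (e : Ed) (x y : V) :=
  inc e x y \/ inc e y x.

Fixpoint mg_walk (V Ed : Type) (es : Ed -> Prop) (inc : Ed -> V -> V -> Prop)
  (x : V) (p : seq (Ed * V)) : Prop :=
  match p with
  | [::] => True
  | (e, y) :: p' => es e /\ mg_link inc e x y /\ mg_walk es inc y p'
  end.

Definition mg_connected (V Ed : Type) (vs : V -> Prop) (es : Ed -> Prop)
  (inc : Ed -> V -> V -> Prop) : Prop :=
  forall x y, vs x -> vs y ->
    exists p, mg_walk es inc x p /\ last x (map snd p) = y.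

(* a cycle: closed walk of length >= 1 with distinct edges and distinct
   vertices (parallel edges give cycles of length 2) *)
Definition mg_has_cycle (V Ed : eqType) (es : Ed -> Prop)
  (inc : Ed -> V -> V -> Prop) : Prop :=
  exists (x : V) (p : seq (Ed * V)),
    p <> [::] /\ mg_walk es inc x p /\ last x (map snd p) = x /\
    uniq (map fst p) /\ uniq (map snd p).

Definition mg_is_tree (V Ed : eqType) (vs : V -> Prop) (es : Ed -> Prop)
  (inc : Ed -> V -> V -> Prop) : Prop :=
  mg_connected vs es inc /\ ~ mg_has_cycle es inc.

Definition cg_vertex (n : nat) (t1 t2 : btree 'I_n)
  (v : {set 'I_n} + {set 'I_n}) : Prop :=
  match v with
  | inl c => c \in clades t1
  | inr c => c \in clades t2
  end.

Definition cg_inc (n : nat) (t1 t2 : btree 'I_n) (e : {set 'I_n})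
  (x y : {set 'I_n} + {set 'I_n}) : Prop :=
  exists c1 c2, x = inl c1 /\ y = inr c2 /\
    smallest_clade t1 e c1 /\ smallest_clade t2 e c2.

Definition clade_graph_is_tree (n : nat) (E : {set {set 'I_n}})
  (t1 t2 : btree 'I_n) : Prop :=
  @mg_is_tree ({set 'I_n} + {set 'I_n})%type {set 'I_n}
    (cg_vertex t1 t2) (fun e => e \in E) (cg_inc t1 t2).

Local Open Scope ring_scope.

Definition sqdist (R : realType) (a b : R * R) : R :=
  (a.1 - b.1) ^+ 2 + (a.2 - b.2) ^+ 2.

Definition euclid_isometry (R : realType) (f : R * R -> R * R) : Prop :=
  forall a b, sqdist (f a) (f b) = sqdist a b.

Definition framework_rigid (R : realType) (n : nat) (E : {set {set 'I_n}})
  (p : 'I_n -> R * R) : Prop :=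
  injective p /\
  exists2 eps : R, 0 < eps &
    forall q : 'I_n -> R * R, injective q ->
      \sum_(u < n) sqdist (p u) (q u) <= eps ->
      (forall u v, [set u; v] \in E -> sqdist (q u) (q v) = sqdist (p u) (p v)) ->
      exists f, euclid_isometry f /\
        (forall z, (exists u, q u = z) <-> (exists u, f (p u) = z)).

Definition coords (R : realType) (n : nat) (p : 'I_n -> R * R) : 'I_(n + n) -> R :=
  fun i => match split i with inl u => (p u).1 | inr u => (p u).2 end.

Definition generic_config (R : realType) (n : nat) (p : 'I_n -> R * R) : Prop :=
  forall P : {mpoly rat[n + n]}, P != 0 ->
    (map_mpoly (ratr : rat -> R) P).@[coords p] != 0.

Definition generically_rigid (R : realType) (n : nat) (E : {set {set 'I_n}}) : Prop :=
  forall p : 'I_n -> R * R, generic_config p -> framework_rigid E p.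

Definition generically_minimally_rigid (R : realType) (n : nat)
  (E : {set {set 'I_n}}) : Prop :=
  generically_rigid R E /\ forall e, e \in E -> ~ generically_rigid R (E :\ e).

(* Main.v *)
Require Import Defs.
From HB Require Import structures.
From mathcomp Require Import all_boot all_order all_algebra.
From mathcomp Require Import reals.
From mathcomp Require boolp classical_sets.
From mathcomp Require Import zify ring lra.
From mathcomp Require Import mpoly.
Set Implicit Arguments.
Unset Strict Implicit.
Unset Printing Implicit Defensive.
Import Order.TTheory GRing.Theory Num.Theory.

(* Proof idea.
   (1) => (2): a vertex of degree at most 3 is removed.  For a vertex of degree
   3, if no edge could be added between two of its neighbours then the
   neighbours would lie pairwise in tight sets (sets S spanning 2|S| - 3 edges);
   tight sets merge along two common vertices, and three of them merge when they
   form a triangle, so one tight set would contain all three neighbours.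
   (2) => (3): a new vertex x is grafted as a sibling of a neighbour u in T1 and
   of a neighbour v in T2.  The edges xu and xv hang the two new clades on the
   old graph and, for a third neighbour w, the edge xw joins c1(uw) to c2(vw).
   Deleting the edge ij of a move (ii) leaves the components A of c1(ij) and B of
   c2(ij); if c2(jk) is in B take w = j, if c1(ik) is in A take w = i, and
   otherwise w = k: the edge xw always reconnects A and B.
   (3) => (1): restricted to S, the clade graph is a forest meeting at most
   |S| - 1 clades of each tree; connectedness yields 2n - 3 edges in total.
   (1) => (4): independence of the rows of the rigidity matrix propagates along
   Henneberg moves and is a polynomial condition, so it holds at generic p.
   Writing m = (p + q) / 2, equality of edge lengths is linear in q - p with the
   matrix taken at m; independence and counting make q - p an infinitesimal
   isometry of m, and the Cayley transform turns this into an isometry p -> q.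
   (4) => (1): let B be a maximal sparse subset of E.  If B is not Laman it
   extends to a sparse B + uv; by independence at p the length of uv can be
   perturbed with the lengths in B fixed, the other edges of E keep their length
   since they lie in rigid B-tight sets, and so E is flexible.  Hence B is Laman
   and rigid, and minimality forces E = B. *)

(* Cardinalities of sets of sets occur in convertible but syntactically distinct
   forms, which [lia] would take for distinct atoms: they are abstracted first. *)
Ltac card_lia :=
  intros;
  repeat match goal with H : ?P |- _ =>
    lazymatch P with
    | is_true (leq _ _) => revert H
    | @eq nat _ _ => revert H
    | not (@eq nat _ _) => revert H
    | _ => clear H
    end
  end;
  repeat (let k := fresh "k" in set k := (#|_|); move: k => k);
  lia.

(** * Sparse graphs and tight sets *)

Section Sparsity.
Variable T : finType.
Implicit Types (E F : {set {set T}}) (S U V W X Y Z e : {set T}) (a b c x y : T).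

Definition induced E S := [set e in E | e \subset S].

(** The bound is additive, so no truncated subtraction occurs, and only the full induced edge set of
    S is tested, since it is the largest edge set spanned by S. *)
Definition sparse E := forall S, (2 <= #|S|)%N -> (#|induced E S| + 3 <= 2 * #|S|)%N.

Definition tight E S := (2 <= #|S|)%N /\ (#|induced E S| + 3 = 2 * #|S|)%N.

Lemma induced_setT E : induced E setT = E.
Proof. by apply/setP=> e; rewrite inE subsetT andbT. Qed.

Lemma sub_induced E F S U : E \subset F -> S \subset U -> induced E S \subset induced F U.
Proof.
move=> /subsetP sEF sSU; apply/subsetP=> e; rewrite !inE => /andP[/sEF -> /=].
by move/subset_trans; apply.
Qed.

Lemma sub_sparse E F : E \subset F -> sparse F -> sparse E.
Proof.
move=> sEF spF S /spF; apply: leq_trans; rewrite leq_add2r.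
exact/subset_leq_card/sub_induced.
Qed.

(** Induced edge counts are supermodular: the counts of S and U add up to at most those of the union
    and the intersection. The intersection obeys the sparsity bound, so the union has to attain
    it. *)
Lemma tight_cup E S U : sparse E -> tight E S -> tight E U ->
  (2 <= #|S :&: U|)%N -> tight E (S :|: U).
Proof.
move=> spE [S2 tS] [U2 tU] SU2.
have SU2' : (2 <= #|S :|: U|)%N by rewrite (leq_trans S2) ?subset_leq_card ?subsetUl.
split=> //; have := spE _ SU2'; have := spE _ SU2.
have cSU := cardsUI S U; have := cardsUI (induced E S) (induced E U).
have -> : induced E S :&: induced E U = induced E (S :&: U).
  by apply/setP=> e; rewrite !inE subsetI; case: (e \in E).
have : (#|induced E S :|: induced E U| <= #|induced E (S :|: U)|)%N.
  by rewrite subset_leq_card // subUset !sub_induced ?subsetUl ?subsetUr.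
card_lia.
Qed.

(* If the pairwise intersections are singletons, the three induced edge sets
   are disjoint and the counts (2s-3)+(2t-3)+(2u-3) = 2(s+t+u-3)-3 add up. *)
Lemma tight_triangle E X Y Z a b c : simple_graph E -> sparse E ->
  tight E X -> tight E Y -> tight E Z -> a != b -> b != c -> a != c ->
  a \in X :&: Y -> b \in Y :&: Z -> c \in X :&: Z ->
  exists2 W, tight E W & [set a; b; c] \subset W.
Proof.
move=> simE spE tX tY tZ nab nbc nac; rewrite !inE.
move=> /andP[aX aY] /andP[bY bZ] /andP[cX cZ].
have sub3 W : a \in W -> b \in W -> c \in W -> [set a; b; c] \subset W.
  by move=> aW bW cW; rewrite !subUset !sub1set aW bW cW.
case: (leqP 2 #|X :&: Y|) => [XY|XY].
  by exists (X :|: Y); [exact: tight_cup|apply: sub3; rewrite inE ?aX ?bY ?cX ?orbT].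
case: (leqP 2 #|Y :&: Z|) => [YZ|YZ].
  by exists (Y :|: Z); [exact: tight_cup|apply: sub3; rewrite inE ?aY ?bY ?cZ ?orbT].
case: (leqP 2 #|X :&: Z|) => [XZ|XZ].
  by exists (X :|: Z); [exact: tight_cup|apply: sub3; rewrite inE ?aX ?bZ ?cX ?orbT].
have one (A : {set T}) x : x \in A -> (#|A| < 2)%N -> A = [set x].
  by move=> xA A1; apply/esym/eqP; rewrite eqEcard sub1set xA cards1.
have eXY : X :&: Y = [set a] by apply: one; rewrite // inE aX.
have eYZ : Y :&: Z = [set b] by apply: one; rewrite // inE bY.
have eXZ : X :&: Z = [set c] by apply: one; rewrite // inE cX.
exists (X :|: Y :|: Z); last by apply: sub3; rewrite !inE ?aX ?bY ?cX ?orbT.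
have cXYZ : (X :|: Y) :&: Z = [set c; b] by rewrite setIUl eXZ eYZ.
have disj P Q x : P :&: Q = [set x] -> induced E P :&: induced E Q = set0.
  move=> ePQ; apply/setP=> e; rewrite !inE; apply/negP=> /andP[/andP[eE eP] /andP[_ eQ]].
  have := simE _ eE; have : e \subset P :&: Q by rewrite subsetI eP.
  by rewrite ePQ => /subset_leq_card; rewrite cards1 => le1 e2; rewrite e2 in le1.
have := cardsUI X Y; rewrite eXY cards1.
have := cardsUI (X :|: Y) Z; rewrite cXYZ cards2 eq_sym nbc.
have := cardsUI (induced E X) (induced E Y); rewrite (disj _ _ _ eXY) cards0.
have := cardsUI (induced E X :|: induced E Y) (induced E Z).
rewrite setIUl (disj _ _ _ eXZ) (disj _ _ _ eYZ) setU0 cards0.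
have : (#|induced E X :|: induced E Y :|: induced E Z| <= #|induced E (X :|: Y :|: Z)|)%N.
  rewrite subset_leq_card // !subUset !sub_induced ?subsetUr //.
    by rewrite setUAC subsetUr.
  by rewrite -setUA subsetUl.
have W2 : (2 <= #|X :|: Y :|: Z|)%N.
  by apply: leq_trans tZ.1 _; rewrite subset_leq_card ?subsetUr.
move: (spE _ W2) tX.2 tY.2 tZ.2 => *; split=> //; card_lia.
Qed.

Lemma edge_tight E a b : sparse E -> a != b -> [set a; b] \in E -> tight E [set a; b].
Proof.
move=> spE nab abE; have c2 : #|[set a; b]| = 2%N by rewrite cards2 nab.
split; first by rewrite c2.
have : [set [set a; b]] \subset induced E [set a; b] by rewrite sub1set inE abE subxx.
move/subset_leq_card; rewrite cards1.
move: (spE [set a; b]); rewrite c2 => /(_ isT). card_lia.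
Qed.

(** The new edge adds at most one to the count, and only for sets containing both ends; none of
    these is tight, so each has room for one more edge. *)
Lemma sparse_setU1 E a b : sparse E ->
  (forall W, tight E W -> ~~ ([set a; b] \subset W)) -> sparse ([set a; b] |: E).
Proof.
move=> spE nt S S2; case: (boolP ([set a; b] \subset S)) => abS; last first.
  suff -> : induced ([set a; b] |: E) S = induced E S by exact: spE.
  by apply/setP=> e; rewrite !inE; case: eqVneq => [->|_] //=; rewrite (negPf abS) !andbF.
have : induced ([set a; b] |: E) S \subset [set a; b] |: induced E S.
  by apply/subsetP=> e; rewrite !inE => /andP[eaE ->]; rewrite andbT.
move/subset_leq_card; rewrite cardsU1.
have := spE _ S2; have : (#|induced E S| + 3 <> 2 * #|S|)%N.
  by move=> eS; have := nt S (conj S2 eS); rewrite abS.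
by case: (_ \notin _) => /=; card_lia.
Qed.

(** If every pair lay in a tight set, take a largest tight set S, a vertex v outside it and a, b in
    S. Tight sets through va and vb form a triangle with S; the merged set meets S in a and b, so
    its union with S is tight and larger. Hence S is everything, against the edge count. *)
Lemma exists_sparse_setU1 E : (2 <= #|T|)%N -> simple_graph E -> sparse E ->
  (#|E| + 3 < 2 * #|T|)%N ->
  exists a b, [/\ a != b, [set a; b] \notin E & sparse ([set a; b] |: E)].
Proof.
move=> T2 simE spE E3.
pose ok a b := [exists W : {set T}, [&& 2 <= #|W|, #|induced E W| + 3 == 2 * #|W| & [set a; b] \subset W]]%N.
case: (boolP [exists a, exists b, (a != b) && ~~ ok a b]).
  case/existsP=> a /existsP[b /andP[nab nok]]; exists a, b.
  have nt W : tight E W -> ~~ ([set a; b] \subset W).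
    move=> [W2 tW]; apply: contra nok => abW; apply/existsP; exists W.
    by rewrite W2 tW eqxx.
  split=> //; last exact: sparse_setU1.
  apply/negP=> abE; have := nt _ (edge_tight spE nab abE).
  by rewrite subxx.
move/existsPn=> allok.
have {allok} all a b : a != b -> exists2 W, tight E W & [set a; b] \subset W.
  move=> nab; have /existsPn/(_ b) := allok a; rewrite nab negbK /=.
  by case/existsP=> W /and3P[W2 /eqP tW abW]; exists W.
pose P (S : {set T}) := [&& 2 <= #|S| & #|induced E S| + 3 == 2 * #|S|]%N.
have /card_gt1P[a0 [b0 [_ _ nab0]]] : (1 < #|[set: T]|)%N by rewrite cardsT.
have [W0 [W02 tW0] _] := all _ _ nab0.
have PW0 : P W0 by rewrite /P W02 tW0 eqxx.
case: (arg_maxnP (fun S => #|S|) PW0) => S /andP[S2 /eqP tS] maxS.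
have tightS : tight E S by [].
case: (eqVneq S setT) => [eS|].
  move: tS; rewrite eS cardsT.
  by rewrite induced_setT => eE; rewrite -eE ltnn in E3.
rewrite -subTset => /subsetPn[v _ vS].
have /card_gt1P[a [b [aS bS nab]]] := S2.
have nva : v != a by apply: contraNneq vS => ->.
have nvb : v != b by apply: contraNneq vS => ->.
have [X tX vaX] := all _ _ nva; have [Y tY vbY] := all _ _ nvb.
move: vaX vbY; rewrite !subUset !sub1set => /andP[vX aX] /andP[vY bY].
have [||||W tW] := tight_triangle simE spE tX tY tightS (nvb : v != b) _ nva.
- by rewrite eq_sym.
- by rewrite inE vX.
- by rewrite inE bY.
- by rewrite inE aX.
rewrite !subUset !sub1set => /andP[/andP[vW bW] aW].
have SW : (2 <= #|S :&: W|)%N.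
  have : [set a; b] \subset S :&: W by rewrite subUset !sub1set !inE aS bS aW bW.
  by move/subset_leq_card; rewrite cards2 nab.
have [SW2 tSW] := tight_cup spE tightS tW SW.
have := maxS (S :|: W); rewrite /P SW2 tSW eqxx /= leqNgt => /(_ isT)/negP[].
have : v |: S \subset S :|: W by rewrite subUset sub1set inE vW orbT subsetUl.
by move/subset_leq_card; rewrite cardsU1 vS.
Qed.

(** Edges are added until the count is maximal. This transfers generic independence from Laman
    graphs to all sparse graphs. *)
Lemma sparse_extend E : (2 <= #|T|)%N -> simple_graph E -> sparse E ->
  exists2 L : {set {set T}}, E \subset L & [/\ simple_graph L, sparse L & (#|L| + 3 = 2 * #|T|)%N].
Proof.
move=> T2; have [k] := ubnP (2 * #|T| - #|E|).
elim: k E => // k IH E lek simE spE.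
have := spE setT; rewrite induced_setT cardsT => /(_ T2).
rewrite leq_eqVlt => /orP[/eqP eE|ltE]; first by exists E.
have [a [b [nab abE spE']]] := exists_sparse_setU1 T2 simE spE ltE.
have [||L sEL hL] := IH ([set a; b] |: E) _ _ spE'.
- by rewrite cardsU1 abE; card_lia.
- by move=> e; rewrite !inE => /orP[/eqP->|/simE//]; rewrite cards2 nab.
by exists L => //; apply: subset_trans sEL; rewrite subsetUr.
Qed.

(** * Laman graphs are Henneberg *)

Definition incident E x := [set e in E | x \in e].

Lemma sum_incident V E : simple_graph E -> (forall e, e \in E -> e \subset V) ->
  (\sum_(x in V) #|incident E x| = 2 * #|E|)%N.
Proof.
move=> simE subV.
transitivity (\sum_(x in V) \sum_(e in E) (x \in e))%N.
  apply: eq_bigr => x _; rewrite -sum1_card big_mkcond [RHS]big_mkcond /=.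
  by apply: eq_bigr => e _; rewrite inE; case: (e \in E); case: (x \in e).
rewrite exchange_big /=; transitivity (\sum_(e in E) 2)%N; last by rewrite sum_nat_const mulnC.
apply: eq_bigr => e eE; transitivity #|e|; last exact: simE.
rewrite -sum1_card big_mkcond [RHS]big_mkcond /=; apply: eq_bigr => x _; case: (boolP (x \in e)) => [xe|]; last by case: ifP.
by rewrite (subsetP (subV _ eE) _ xe).
Qed.

Lemma edge_at E e x : simple_graph E -> e \in E -> x \in e ->
  exists2 y, y != x & e = [set x; y].
Proof.
move=> simE eE xe; have /eqP/cards2P[a [b [nab eab]]] := simE _ eE.
move: xe; rewrite eab !inE => /orP[]/eqP ->; first by exists b; rewrite // eq_sym.
by exists a => //; rewrite setUC.
Qed.

Lemma set2_inj x y z : y != x -> [set x; y] = [set x; z] -> y = z.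
Proof.
move=> nyx /setP/(_ y); rewrite !inE eqxx orbT (negPf nyx) /=.
by move/esym/eqP.
Qed.

Lemma sparse_henneberg V E : (2 <= #|V|)%N -> simple_graph E ->
  (forall e, e \in E -> e \subset V) -> sparse E ->
  (#|E| + 3 = 2 * #|V|)%N -> henneberg V E.
Proof.
have [k] := ubnP #|V|; elim: k V E => // k IH V E ltk V2 simE subV spE cE.
case: (leqP #|V| 2) => [V2'|V3].
  have /eqP/cards2P[a [b [nab eV]]] : #|V| = 2%N by card_lia.
  suff -> : E = [set V] by rewrite eV; exact: Henneberg_K2.
  have /eqP/cards1P[e eE] : #|E| = 1%N by card_lia.
  rewrite eE; congr [set _]; apply/eqP; rewrite eqEcard (simE e) ?eE ?set11 // V2' andbT.
  by apply: subV; rewrite eE set11.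
have [x xV xdeg] : exists2 x, x \in V & (#|incident E x| <= 3)%N.
  apply/exists_inP; apply: contraT => /exists_inPn h.
  (* If all degrees were at least 4, the handshake sum would give 4|V| <= 2|E| = 4|V| - 6. *)
  have : (\sum_(x in V) 4 <= \sum_(x in V) #|incident E x|)%N.
    by apply: leq_sum => x /h; rewrite -ltnNge.
  by rewrite (sum_incident simE subV) sum_nat_const; card_lia.
set V' := V :\ x; have cV' : (#|V'|.+1 = #|V|)%N by rewrite (cardsD1 x V) xV.
set E' := induced E V'.
have E'E : E = incident E x :|: E'.
  apply/setP=> e; rewrite !inE subsetD1; case: (boolP (e \in E)) => //= /subV ->.
  by rewrite orbN.
have cE' : (#|incident E x| + #|E'| = #|E|)%N.
  rewrite -cardsUI -E'E (_ : _ :&: _ = set0) ?cards0 ?addn0 //.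
  by apply/setP=> e; rewrite !inE subsetD1; case: (x \in e); rewrite ?andbF.
have V'2 : (2 <= #|V'|)%N by card_lia.
(* Sparsity on the remaining vertices bounds [E'] by 2|V| - 5, which forces x to have degree at
   least 2. *)
have := spE _ V'2; rewrite -/E' => bE'.
have sE' : E' \subset E by apply/subsetP=> e; rewrite inE => /andP[].
have simE' : simple_graph E' by move=> e /(subsetP sE')/simE.
have spE' : sparse E' by apply: sub_sparse spE.
have subV' e : e \in E' -> e \subset V' by rewrite inE => /andP[].
pose N := [set y | (y != x) && ([set x; y] \in E)].
have incN : incident E x = [set [set x; y] | y in N].
  apply/setP=> e; apply/idP/imsetP => [|[y]].
    rewrite inE => /andP[eE xe]; have [y nyx ey] := edge_at simE eE xe.
    by exists y; rewrite // inE nyx -ey.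
  by rewrite inE => /andP[nyx xyE] ->; rewrite !inE xyE eqxx.
have cN : #|N| = #|incident E x|.
  by rewrite incN card_in_imset // => y z; rewrite inE => /andP[nyx _] _ /set2_inj; apply.
have NV' y : y \in N -> y \in V'.
  rewrite !inE => /andP[-> /subV]; rewrite subUset !sub1set.
  by case/andP.
have eV : x |: V' = V by rewrite setD1K.
case: (leqP #|N| 2) => [N2|N3].
  have /eqP/cards2P[a [b [nab eN]]] : #|N| = 2%N by card_lia.
  have -> : E = [set [set x; a]; [set x; b]] :|: E'.
    by rewrite {1}E'E incN eN imsetU1 imset_set1.
  rewrite -eV; apply: Henneberg_move1 => //; last first.
  - by apply: NV'; rewrite eN !inE eqxx orbT.
  - by apply: NV'; rewrite eN !inE eqxx.
  - by rewrite !inE eqxx.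
  by apply: IH => //; card_lia.
have /card_gt2P[a [b [c [[aN bN cN'] [nab nbc nca]]]]] := N3.
have eN : N = [set a; b; c].
  apply/esym/eqP; rewrite eqEcard !subUset !sub1set aN bN cN' /=.
  by rewrite (setUC _ [set c]) cardsU1 cards2 !inE negb_or nca (eq_sym c) nbc nab cN.
(* This reverses move (ii). A pair in no tight set of [E'] is not yet an edge, because the ends of
   an edge form a tight set, and joining it keeps [E'] sparse. *)
have step i j l : N = [set i; j; l] -> i != j -> l != i -> l != j ->
    (forall W, tight E' W -> ~~ ([set i; j] \subset W)) -> henneberg V E.
  move=> eijl nij nli nlj nt.
  have ijE' : [set i; j] \notin E'.
    by apply/negP=> ijE; have := nt _ (edge_tight spE' nij ijE); rewrite subxx.
  have -> : E = [set [set x; i]; [set x; j]; [set x; l]] :|: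
                (([set i; j] |: E') :\ [set i; j]).
    by rewrite setU1K // {1}E'E incN eijl !imsetU !imset_set1.
  have [iV jV lV] : [/\ i \in V', j \in V' & l \in V'].
    by split; apply: NV'; rewrite eijl !inE eqxx ?orbT.
  rewrite -eV; apply: Henneberg_move2 => //; [|by rewrite !inE eqxx|by rewrite !inE eqxx].
  apply: IH => //; first card_lia.
  - by move=> e; rewrite in_setU1 => /orP[/eqP->|/simE'//]; rewrite cards2 nij.
  - by move=> e; rewrite in_setU1 => /orP[/eqP->|/subV'//]; rewrite subUset !sub1set iV jV.
  - exact: sparse_setU1.
  by rewrite cardsU1 ijE'; card_lia.
have dec i j : (forall W, tight E' W -> ~~ ([set i; j] \subset W)) \/
               (exists2 W, tight E' W & [set i; j] \subset W).
  case: (boolP [exists W : {set T}, [&& 2 <= #|W|, #|induced E' W| + 3 == 2 * #|W| & [set i; j] \subset W]]%N).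
    by case/existsP=> W /and3P[W2 /eqP tW ijW]; right; exists W.
  move/existsPn=> h; left=> W [W2 tW]; apply/negP=> ijW.
  by have := h W; rewrite W2 tW eqxx ijW.
have [nba ncb nac] : [/\ b != a, c != b & a != c] by split; rewrite eq_sym.
have [nt|[X tX abX]] := dec a b; first exact: (step a b c).
have [nt|[Y tY bcY]] := dec b c; first by apply: (step b c a); rewrite // eN -setUA setUC.
have [nt|[Z tZ caZ]] := dec c a; first by apply: (step c a b); rewrite // eN setUC setUA.
exfalso; move: abX bcY caZ; rewrite !subUset !sub1set.
move=> /andP[aX bX] /andP[bY cY] /andP[cZ aZ].
have [|||W [W2 tW]] := tight_triangle simE' spE' tX tY tZ nbc nca nba.
- by rewrite inE bX.
- by rewrite inE cY.
- by rewrite inE aX.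
rewrite !subUset !sub1set => /andP[/andP[bW cW] aW].
(* W spans 2|W| - 3 edges of [E']. With the three edges at x this makes 2|W| edges on |W| + 1
   vertices, one more than sparsity allows. *)
have xE' : incident E x :&: induced E' W = set0.
  by apply/setP=> e; rewrite !inE subsetD1; case: (x \in e); rewrite ?andbF.
have : incident E x :|: induced E' W \subset induced E (x |: W).
  rewrite subUset sub_induced // ?subsetUr // andbT incN.
  apply/subsetP=> e /imsetP[y yN ->]; rewrite inE.
  move: (yN); rewrite inE => /andP[_ ->] /=; rewrite subUset !sub1set !inE eqxx /=.
  by move: yN; rewrite eN !inE => /orP[/orP[]|] /eqP->; rewrite ?aW ?bW ?cW orbT.
move/subset_leq_card; have := cardsUI (incident E x) (induced E' W).
have xW2 : (2 <= #|x |: W|)%N by rewrite (leq_trans W2) // subset_leq_card ?subsetUr.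
have inc3 : (2 < #|incident E x|)%N by rewrite -cN.
by have := spE _ xW2; rewrite xE' cards0 cardsU1; case: (x \notin W) => /=; card_lia.
Qed.

End Sparsity.

(** * Trees as multigraphs *)

Section Multigraphs.
Variables (V Ed : finType) (src tgt : Ed -> V).
Implicit Types (F : {set Ed}) (W : {set V}).

Definition adj F x y :=
  [exists e in F, (src e == x) && (tgt e == y) || (src e == y) && (tgt e == x)].

Lemma adj_sym F : ssrbool.symmetric (adj F).
Proof.
by move=> x y; apply: eq_existsb => e; rewrite orbC.
Qed.

Lemma adj_edge F e : e \in F -> adj F (src e) (tgt e).
Proof. by move=> eF; apply/exists_inP; exists e => //; rewrite !eqxx. Qed.

(** The oriented incidence matrix, with edges as rows: it sends a potential on the vertices to its
    differences along the edges. Its rank compares the numbers of edges and vertices. *)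
Definition incidence_mx F W : 'M[rat]_(#|F|, #|W|) := (\matrix_(i, j)
  ((src (enum_val i) == enum_val j)%:R - (tgt (enum_val i) == enum_val j)%:R))%R.

Lemma incidence_mxE F W (phi : V -> rat) i :
  (forall e, e \in F -> (src e \in W) && (tgt e \in W)) ->
  ((incidence_mx F W *m \col_j phi (enum_val j)) i 0 =
    phi (src (enum_val i)) - phi (tgt (enum_val i)))%R.
Proof.
move=> FW; have delta v : v \in W ->
    (\sum_(j < #|W|) (v == enum_val j)%:R * phi (enum_val j) = phi v)%R.
  move=> vW; rewrite (bigD1 (enum_rank_in vW v)) //= enum_rankK_in // eqxx mul1r.
  rewrite big1 ?addr0 // => j nj; case: eqP => [ev|_]; last by rewrite mul0r.
  by case/eqP: nj; apply: enum_val_inj; rewrite enum_rankK_in.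
have /andP[sW tW] := FW _ (enum_valP i).
rewrite mxE -(delta _ sW) -(delta _ tW) -sumrB.
by apply: eq_bigr => j _; rewrite !mxE mulrBl.
Qed.

(** The rows are independent: for an edge e, the indicator of the component of its source after
    deleting e has difference 1 along e and 0 along every other edge. Constant potentials are
    killed, so the rank is less than |W|. *)
Lemma card_forest F W :
  (forall e, e \in F -> (src e \in W) && (tgt e \in W)) -> W != set0 ->
  (forall e, e \in F -> ~~ connect (adj (F :\ e)) (src e) (tgt e)) ->
  (#|F| < #|W|)%N.
Proof.
move=> FW W0 forest.
pose M := incidence_mx F W; have MphiE phi i := @incidence_mxE F W phi i FW.
have freeM : row_free M.
  apply/row_freeP; suff : (kermx M == 0)%R.
    by rewrite kermx_eq0 => /row_freeP.
  apply/eqP/row_matrixP=> r; rewrite row0; set y := row r _.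
  have yM : (y *m M = 0)%R by rewrite -row_mul mulmx_ker row0.
  apply/rowP=> i; rewrite [RHS]mxE.
  pose phi v : rat := ((connect (adj (F :\ enum_val i)) (src (enum_val i)) v)%:R)%R.
  have := congr1 (fun A => (A *m \col_j phi (enum_val j)) 0 0)%R yM.
  rewrite mul0mx [RHS]mxE -mulmxA mxE (bigD1 i) //= MphiE big1 => [|f nfi].
    rewrite /phi connect0 (negPf (forest _ (enum_valP i))) /=.
    by rewrite mulr1n mulr0n subr0 mulr1.
  rewrite MphiE /phi (same_connect_r (sym_connect_sym (adj_sym _)) (x := src (enum_val f)) (y := tgt (enum_val f))).
    by rewrite subrr mulr0.
  apply/connect1/adj_edge; rewrite !inE enum_valP andbT.
  by rewrite (inj_eq enum_val_inj).
rewrite -(eqnP freeM) ltn_neqAle rank_leq_col andbT; apply/negP=> fullM.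
have : row_free (M^T)%R by rewrite /row_free mxrank_tr.
move/row_free_inj=> /(_ 1 (const_mx 1)%R 0%R); rewrite mul0mx -[(_ *m _)%R]trmxK trmx_mul trmxK.
have -> : ((const_mx 1 : 'rV[rat]_#|W|)^T = \col_j (fun=> 1) (enum_val j : V))%R.
  by apply/matrixP=> i j; rewrite !mxE.
have -> : (M *m \col_j (fun=> 1) (enum_val j : V) = 0)%R.
  by apply/colP=> i; rewrite (MphiE (fun=> 1%R)) subrr mxE.
rewrite trmx0 => /(_ erefl) /rowP h; case/set0Pn: W0 => w wW.
by have := h (enum_rank_in wW w); rewrite !mxE => /eqP; rewrite oner_eq0.
Qed.

(** A potential with zero differences is constant along paths, so the kernel has dimension at most 1
    and the rank is at least |W| - 1. *)
Lemma card_connected F W :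
  (forall e, e \in F -> (src e \in W) && (tgt e \in W)) ->
  {in W &, forall x y, connect (adj F) x y} -> (#|W| <= #|F| + 1)%N.
Proof.
move=> FW conn; pose M := incidence_mx F W.
suff : (\rank (kermx (M^T)) <= 1)%N.
  by rewrite mxrank_ker mxrank_tr; have := rank_leq_row M; lia.
suff /mxrankS/leq_trans : (kermx (M^T) <= (const_mx 1%R : 'rV[rat]_#|W|))%MS.
  by apply; exact: rank_leq_row.
apply/row_subP=> r; set y := row r _.
have yM : (M *m y^T = 0)%R by rewrite -[M]trmxK -trmx_mul -row_mul mulmx_ker row0 trmx0.
case: (set_0Vmem W) => [W0|[w0 w0W]].
  by have := ltn_ord r; rewrite {2}W0 cards0.
pose phi v := y ord0 (enum_rank_in w0W v).
have ephi v : v \in W -> phi v = phi w0.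
  move=> vW; have /connectP[p] := conn _ _ w0W vW.
  elim/last_ind: p v {vW} => [|p z IH] v /=; first by move=> _ ->.
  rewrite rcons_path last_rcons => /andP[/IH-/(_ _ erefl) <- ] + ->.
  move=> /exists_inP[e eF]; have /colP/(_ (enum_rank_in eF e)) := yM.
  have -> : (y^T = \col_j phi (enum_val j))%R.
    by apply/colP=> j; rewrite mxE [RHS]mxE /phi enum_valK_in.
  rewrite incidence_mxE // mxE enum_rankK_in // => /eqP; rewrite subr_eq0 => /eqP ee.
  by case/orP=> /andP[/eqP<- /eqP<-].
apply/sub_rVP; exists (phi w0); apply/rowP=> j; rewrite [RHS]mxE [X in (_ * X)%R]mxE mulr1.
by rewrite -(ephi (enum_val j)) ?enum_valP // /phi enum_valK_in.
Qed.

(** * Walks and cycles in terms of boolean connectivity *)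

Variable inc : Ed -> V -> V -> Prop.

Section Walks.
Variable F : {set Ed}.
Hypothesis incE : forall e x y, e \in F -> inc e x y <-> x = src e /\ y = tgt e.

Lemma walk_connect x p : mg_walk (fun e => e \in F) inc x p ->
  forall G : {set Ed}, (forall e, e \in map fst p -> e \in G) -> connect (adj G) x (last x (map snd p)).
Proof.
elim: p x => [|[e y] p IH] x /=; first by move=> _ G _; exact: connect0.
move=> [eF [exy wp]] G pG; apply: connect_trans (IH _ wp G _); last first.
  by move=> f fp; apply: pG; rewrite inE fp orbT.
apply: connect1; apply/exists_inP; exists e; first by apply: pG; rewrite inE eqxx.
by case: exy => /incE-/(_ eF) [-> ->]; rewrite !eqxx ?orbT.
Qed.

Lemma connect_walk (G : {set Ed}) x y : G \subset F -> connect (adj G) x y ->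
  exists p, [/\ mg_walk (fun e => e \in F) inc x p, last x (map snd p) = y,
    uniq (x :: map snd p) & forall e, e \in map fst p -> e \in G].
Proof.
move=> sGF /connectP[q0 qp ->]; case/shortenP: qp => q qp uq _ {q0}.
suff [p [wp epq pG]] : exists p, [/\ mg_walk (fun e => e \in F) inc x p,
    map snd p = q & forall e, e \in map fst p -> e \in G]
  by exists p; rewrite epq; split.
elim: q x qp {uq} => [|z q IH] x /=; first by exists [::]; split.
move=> /andP[/exists_inP[e eG exz] qp]; have [p [wp lp pG]] := IH z qp.
exists ((e, z) :: p); split=> /=; last by move=> f; rewrite inE => /orP[/eqP->|/pG].
  have eF := subsetP sGF _ eG; split=> //; split=> //.
  by case/orP: exz => /andP[/eqP<- /eqP<-]; [left|right]; apply/incE.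
by rewrite lp.
Qed.

Lemma walk_ends x p f : mg_walk (fun e => e \in F) inc x p -> f \in map fst p ->
  (src f \in x :: map snd p) && (tgt f \in x :: map snd p).
Proof.
elim: p x => [|[e y] p IH] x //= [eF [exy wp]]; rewrite inE => /orP[/eqP->|fp].
  by case: exy => /incE-/(_ eF) [-> ->]; rewrite !inE !eqxx ?orbT.
have /andP[sf tf] := IH _ wp fp.
by rewrite inE sf orbT /= inE tf orbT.
Qed.

(** If the first edge recurred later, the starting vertex, being one of its ends, would be visited
    again. *)
Lemma uniq_walk x p : mg_walk (fun e => e \in F) inc x p ->
  uniq (x :: map snd p) -> uniq (map fst p).
Proof.
elim: p x => [|[e y] p IH] x //= [eF [exy wp]] /andP[xp up].
rewrite (IH y) // andbT; apply/negP=> ep; have := walk_ends wp ep.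
by case: exy => /incE-/(_ eF) [<- <-]; rewrite (negPf xp) ?andbF.
Qed.

(** Acyclic means that every edge is a bridge: a simple path between the ends of e that avoids e is
    closed into a cycle by e, and conversely the rest of a cycle bypasses its first edge. *)
Lemma no_cycleP : ~ mg_has_cycle (fun e => e \in F) inc <->
  (forall e, e \in F -> ~~ connect (adj (F :\ e)) (src e) (tgt e)).
Proof.
split=> [nc e eF|forest [x [[|[e y] p] [// _ [[eF [exy wp]] [lp [up _]]]]]]].
  apply/negP=> cF; apply: nc.
  have [p [wp lp up pF]] := connect_walk (subD1set _ _) cF.
  have ee : mg_link inc e (tgt e) (src e) by right; apply/incE.
  exists (tgt e), ((e, src e) :: p); split=> //; split=> //; split=> //; split=> //.
  rewrite /= (uniq_walk wp) // andbT; apply/negP=> /pF.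
  by rewrite !inE eqxx.
move: lp up => /= lp /andP[ep up].
have := walk_connect wp (G := F :\ e); rewrite lp => cyx.
have {}cyx : connect (adj (F :\ e)) y x.
  apply: cyx => f fp; rewrite !inE (contraNneq _ ep) /=; last by move=> <-.
  elim: p y wp fp {lp ep up exy} => //= [[g z] p IH] y [gF [_ wp]].
  by rewrite inE => /orP[/eqP->|/IH]; auto; apply; exact: wp.
have := forest _ eF; case: exy => /incE-/(_ eF) [<- <-].
  by rewrite (sym_connect_sym (adj_sym _)) cyx.
by rewrite cyx.
Qed.

Lemma is_treeP (vs : V -> Prop) W : (forall v, vs v <-> v \in W) ->
  (forall e, e \in F -> (src e \in W) && (tgt e \in W)) ->
  mg_is_tree vs (fun e => e \in F) inc <->
  {in W &, forall x y, connect (adj F) x y} /\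
  (forall e, e \in F -> ~~ connect (adj (F :\ e)) (src e) (tgt e)).
Proof.
move=> vsW FW; split=> [[conn /no_cycleP forest]|[conn forest]]; split=> //.
- move=> x y /vsW xW /vsW yW; have [p [wp <-]] := conn _ _ xW yW.
  apply: (walk_connect wp) => e ep.
  elim: p x {xW} wp ep => //= [[g z] p IH] x [gF [_ wp]].
  by rewrite inE => /orP[/eqP->//|]; exact: IH wp.
- move=> x y /vsW xW /vsW yW; have [p [wp lp _ _]] := connect_walk (subxx F) (conn _ _ xW yW).
  by exists p.
exact/no_cycleP.
Qed.

End Walks.
End Multigraphs.

(** * Clades *)

Section Clades.
Variable n : nat.
Implicit Types (t l r : btree 'I_n) (e c d S : {set 'I_n}) (x u v w : 'I_n).

Definition leafset t : {set 'I_n} := [set x in leaves t].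

(** A computable candidate for the smallest clade of t containing e. The value at a leaf, which is
    not a clade, is a default. *)
Fixpoint lca t e : {set 'I_n} :=
  match t with
  | BLeaf x => [set x]
  | BNode l r => if e \subset leafset l then lca l e
                 else if e \subset leafset r then lca r e else leafset t
  end.

Lemma leafsetN l r : leafset (BNode l r) = leafset l :|: leafset r.
Proof. by apply/setP=> x; rewrite !inE mem_cat. Qed.

Lemma cladesN l r : clades (BNode l r) = leafset (BNode l r) :: (clades l ++ clades r).
Proof. by []. Qed.

Lemma uniq_leavesN l r : uniq (leaves (BNode l r)) ->
  [/\ uniq (leaves l), uniq (leaves r) & [disjoint leafset l & leafset r]].
Proof.
rewrite /= cat_uniq => /and3P[ul lr ur]; split=> //.
apply/pred0P=> x /=; rewrite !inE; apply/negP=> /andP[xl xr].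
by case/hasP: lr; exists x.
Qed.

Lemma clades_sub t c : c \in clades t -> c \subset leafset t.
Proof.
elim: t => [x|l IHl r IHr] //; rewrite /= inE mem_cat leafsetN.
case/or3P=> [/eqP->|/IHl/subset_trans|/IHr/subset_trans]; [|apply; exact: subsetUl|apply; exact: subsetUr].
by rewrite -leafsetN.
Qed.

Lemma leaves_neq0 t : (0 < size (leaves t))%N.
Proof. by elim: t => //= l IHl r _; rewrite size_cat ltn_addr. Qed.

Lemma card_leafset t : uniq (leaves t) -> #|leafset t| = size (leaves t).
Proof. by move=> ut; rewrite cardsE; exact/card_uniqP. Qed.

Lemma leafset_neq0 t : leafset t != set0.
Proof.
apply/set0Pn; have := leaves_neq0 t; rewrite /leafset.
by case: leaves => // x s _; exists x; rewrite !inE eqxx.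
Qed.

Lemma clades_gt1 t c : uniq (leaves t) -> c \in clades t -> (2 <= #|c|)%N.
Proof.
elim: t => [x|l IHl r IHr] // ut; have [ul ur _] := uniq_leavesN ut.
rewrite /= inE mem_cat => /or3P[/eqP->|/(IHl ul)//|/(IHr ur)//].
rewrite -/(leafset (BNode l r)) card_leafset //= size_cat.
by have := leaves_neq0 l; have := leaves_neq0 r; lia.
Qed.

Lemma size_clades t : (size (clades t)).+1 = size (leaves t).
Proof. by elim: t => [x|l IHl r IHr] //=; rewrite !size_cat -IHl -IHr; lia. Qed.

Lemma clades_disjoint l r c d : uniq (leaves (BNode l r)) -> c \in clades l ->
  c \subset d -> ~~ (d \subset leafset r).
Proof.
move=> ut cl cd; have [ul _ dlr] := uniq_leavesN ut; apply/negP=> dr.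
have /card_gt0P[x xc] : (0 < #|c|)%N by apply: leq_trans (clades_gt1 ul cl).
move/pred0P/(_ x): dlr; rewrite /= (subsetP (clades_sub cl)) //.
by rewrite (subsetP dr) // (subsetP cd).
Qed.

Lemma uniq_clades t : uniq (leaves t) -> uniq (clades t).
Proof.
elim: t => [x|l IHl r IHr] // ut; have [ul ur dlr] := uniq_leavesN ut.
rewrite cladesN cons_uniq mem_cat cat_uniq IHl // IHr // andbT negb_or -andbA.
apply/and3P; split.
- apply/negP=> /clades_sub; rewrite leafsetN subUset subxx /= => rl.
  case/set0Pn: (leafset_neq0 r) => x xr; move/pred0P/(_ x): dlr => /=.
  by rewrite xr (subsetP rl).
- apply/negP=> /clades_sub; rewrite leafsetN subUset subxx andbT => lr.
  case/set0Pn: (leafset_neq0 l) => x xl; move/pred0P/(_ x): dlr => /=.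
  by rewrite xl (subsetP lr).
apply/hasPn=> c cr; apply/negP=> cl.
by have := clades_disjoint ut cl (subxx c); rewrite (clades_sub cr).
Qed.

Lemma lca_clade t e : (2 <= #|e|)%N -> e \subset leafset t -> lca t e \in clades t.
Proof.
move=> e2; elim: t => [x|l IHl r IHr] et.
  have := subset_leq_card et.
  have -> : leafset (BLeaf x) = [set x] by apply/setP=> y; rewrite !inE.
  by rewrite cards1 leqNgt e2.
rewrite [lca _ _]/= [clades _]/=; case: ifP => [/IHl|_].
  by rewrite inE mem_cat => ->; rewrite orbT.
case: ifP => [/IHr|_]; last by rewrite inE eqxx.
by rewrite inE mem_cat => ->; rewrite !orbT.
Qed.

Lemma sub_lca t e : (2 <= #|e|)%N -> e \subset leafset t -> e \subset lca t e.
Proof.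
move=> e2; elim: t => [x|l IHl r IHr] et; last first.
  by rewrite [lca _ _]/=; case: ifP => [/IHl//|_]; case: ifP => [/IHr|].
by apply: subset_trans et _; apply/subsetP=> y; rewrite !inE.
Qed.

Lemma lca_min t e c : uniq (leaves t) -> (2 <= #|e|)%N -> e \subset leafset t ->
  c \in clades t -> e \subset c -> lca t e \subset c.
Proof.
move=> + e2; elim: t => [x|l IHl r IHr] // ut et; have [ul ur dlr] := uniq_leavesN ut.
rewrite [clades _]/= inE mem_cat => /or3P[/eqP-> _|cl ec|cr ec].
- by rewrite -/(leafset (BNode l r)); apply/clades_sub/lca_clade.
- have el := subset_trans ec (clades_sub cl).
  by rewrite /= el IHl.
have er := subset_trans ec (clades_sub cr).
rewrite /= er ifN ?IHr //; apply/negP=> el.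
have /card_gt0P[x xe] : (0 < #|e|)%N by apply: leq_trans e2.
by move/pred0P/(_ x): dlr; rewrite /= (subsetP el) // (subsetP er).
Qed.

Lemma smallest_cladeP t e c : uniq (leaves t) -> (2 <= #|e|)%N -> e \subset leafset t ->
  smallest_clade t e c <-> c = lca t e.
Proof.
move=> ut e2 et; split=> [[ct [ec cmin]]|->]; last first.
  split; first exact: lca_clade.
  split; first exact: sub_lca.
  by move=> c'; exact: lca_min.
by apply/eqP; rewrite eqEsubset cmin ?lca_clade ?sub_lca // lca_min.
Qed.

(** * Counting the clades that branch inside a vertex subset *)

Definition lcas t S := [set lca t e | e in [set e : {set 'I_n} |
  [&& #|e| == 2%N, e \subset S & e \subset leafset t]]].

(** The root is the smallest clade of a pair in S only if both subtrees meet S. In that case (a - 1)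
    + (b - 1) + 1 = a + b - 1 clades arise; if one side misses S, its truncated predecessor is 0 and
    nothing is added. *)
Lemma card_lcas t S : uniq (leaves t) -> (#|lcas t S| <= #|S :&: leafset t|.-1)%N.
Proof.
elim: t => [x _|l IHl r IHr ut].
  rewrite (_ : #|_| = 0)%N //; apply/eqP; rewrite cards_eq0; apply/eqP/setP=> c; rewrite in_set0.
  apply/imsetP=> -[e]; rewrite inE => /and3P[/eqP e2 _ /subset_leq_card].
  by rewrite e2 /leafset /= (_ : [set y in [:: x]] = [set x]) ?cards1 //; apply/setP=> y; rewrite !inE.
pose a := (S :&: leafset l != set0); pose b := (S :&: leafset r != set0).
have sub : lcas (BNode l r) S \subset
    lcas l S :|: lcas r S :|: (if a && b then [set leafset (BNode l r)] else set0).
  apply/subsetP=> c /imsetP[e]; rewrite inE => /and3P[e2 eS et] ->; rewrite [lca _ _]/=.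
  case: ifP => [el|nel].
    by rewrite !inE (_ : lca l e \in _) //; apply/imsetP; exists e; rewrite // inE e2 eS el.
  case: ifP => [er|ner].
    by rewrite !inE (_ : lca r e \in lcas r S) ?orbT //; apply/imsetP; exists e; rewrite // inE e2 eS er.
  rewrite ifT; first by rewrite !inE eqxx !orbT.
  move: et; rewrite leafsetN => et.
  apply/andP; split.
    move/negbT: ner => /subsetPn[x xe xr]; apply/set0Pn; exists x.
    by move: (subsetP et _ xe); rewrite !in_setU (negPf xr) orbF in_setI (subsetP eS) // => ->.
  move/negbT: nel => /subsetPn[x xe xl]; apply/set0Pn; exists x.
  by move: (subsetP et _ xe); rewrite !in_setU (negPf xl) in_setI (subsetP eS) // => ->.
have [ul ur dlr] := uniq_leavesN ut.
have := subset_leq_card sub; have := IHl ul; have := IHr ur.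
have := (leq_card_setU (lcas l S :|: lcas r S) (if a && b then [set leafset (BNode l r)] else set0)).1.
have := (leq_card_setU (lcas l S) (lcas r S)).1.
have cS : #|S :&: leafset (BNode l r)| = (#|S :&: leafset l| + #|S :&: leafset r|)%N.
  rewrite leafsetN setIUr; apply/eqP; rewrite (leq_card_setU _ _).2.
  by apply: disjointW dlr; exact: subsetIr.
have -> : #|if a && b then [set leafset (BNode l r)] else set0| = (a && b : nat).
  by case: ifP; rewrite ?cards1 ?cards0.
rewrite cS /a /b -!card_gt0; clear.
by case: (posnP #|S :&: leafset l|) => [->|?]; case: (posnP #|S :&: leafset r|) => [->|?] /=; card_lia.
Qed.

End Clades.

(** * Clade graphs *)

Section CladeGraphs.
Variable n : nat.
Implicit Types (t l r : btree 'I_n) (e c d S : {set 'I_n}) (x u v w : 'I_n) (E F : {set {set 'I_n}}).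

Definition sum_set (A B : {set {set 'I_n}}) : {set ({set 'I_n} + {set 'I_n})} :=
  [set v | match v with inl c => c \in A | inr c => c \in B end].

Lemma card_sum_set (A B : {set {set 'I_n}}) : #|sum_set A B| = (#|A| + #|B|)%N.
Proof.
rewrite -!sum1_card big_mkcond big_sumType /= [in RHS]big_mkcond [X in (_ + X)%N = _]big_mkcond.
by congr (_ + _)%N; [|rewrite [RHS]big_mkcond]; apply: eq_bigr => c _; rewrite inE.
Qed.

Definition clade_src t e : ({set 'I_n} + {set 'I_n})%type := inl (lca t e).
Definition clade_tgt t e : ({set 'I_n} + {set 'I_n})%type := inr (lca t e).
Definition clade_vertices t1 t2 := sum_set [set c in clades t1] [set c in clades t2].

Lemma edge_clade_vertices t1 t2 e : (2 <= #|e|)%N -> e \subset leafset t1 ->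
  e \subset leafset t2 ->
  (clade_src t1 e \in clade_vertices t1 t2) && (clade_tgt t2 e \in clade_vertices t1 t2).
Proof. by move=> e2 e1 e2'; rewrite !in_set /= !in_set !lca_clade. Qed.

Lemma leafset_full t : binary_tree_on t -> leafset t = setT.
Proof. by move=> /perm_mem mt; apply/setP=> x; rewrite !inE mt mem_enum. Qed.

Lemma uniq_full t : binary_tree_on t -> uniq (leaves t).
Proof. by move=> /perm_uniq->; exact: enum_uniq. Qed.

Lemma card_clade_vertices t1 t2 : binary_tree_on t1 -> binary_tree_on t2 ->
  (#|clade_vertices t1 t2| + 2 = 2 * n)%N.
Proof.
have h t : binary_tree_on t -> (#|[set c in clades t]|.+1 = n)%N.
  move=> bt; rewrite cardsE (card_uniqP (uniq_clades (uniq_full bt))) size_clades.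
  by rewrite (perm_size bt) size_enum_ord.
by move=> /h h1 /h h2; rewrite card_sum_set; card_lia.
Qed.

Lemma clade_graph_treeP E t1 t2 : simple_graph E -> binary_tree_on t1 -> binary_tree_on t2 ->
  clade_graph_is_tree E t1 t2 <->
  {in clade_vertices t1 t2 &, forall p q,
     connect (adj (clade_src t1) (clade_tgt t2) E) p q} /\
  (forall e, e \in E ->
     ~~ connect (adj (clade_src t1) (clade_tgt t2) (E :\ e)) (clade_src t1 e) (clade_tgt t2 e)).
Proof.
move=> simE b1 b2; apply: is_treeP.
- move=> e p q eE; have lcaE t c : binary_tree_on t -> smallest_clade t e c <-> c = lca t e.
    move=> bt; apply: smallest_cladeP; first exact: uniq_full.
      by rewrite (simE e eE).
    by rewrite leafset_full ?subsetT.
  split=> [[c1 [c2 [-> [-> [/lcaE-> // /lcaE-> //]]]]]|[-> ->]] //.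
  by exists (lca t1 e), (lca t2 e); do 3?split=> //; exact/lcaE.
- by case=> c; rewrite !inE.
by move=> e eE; apply: edge_clade_vertices; rewrite ?leafset_full ?subsetT ?simE.
Qed.

Lemma sub_adj (V Ed : finType) (src tgt : Ed -> V) (F G : {set Ed}) : F \subset G ->
  subrel (connect (adj src tgt F)) (connect (adj src tgt G)).
Proof.
move=> sFG; apply: connect_sub => p q /exists_inP[e eF h]; apply: connect1.
by apply/exists_inP; exists e; rewrite // (subsetP sFG).
Qed.

(** The edges inside S form a forest on at most 2(|S| - 1) clades, hence number at most 2|S| - 3.
    Connectedness on all 2n - 2 clades gives the opposite inequality for S = [n]. *)
Lemma trees_laman E t1 t2 : (2 <= n)%N -> simple_graph E ->
  binary_tree_on t1 -> binary_tree_on t2 -> clade_graph_is_tree E t1 t2 -> laman E.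
Proof.
move=> n2 simE b1 b2 /(clade_graph_treeP simE b1 b2)[conn forest].
have sp S F : (2 <= #|S|)%N -> F \subset E -> (forall e, e \in F -> e \subset S) ->
    (#|F| <= 2 * #|S| - 3)%N.
  move=> S2 sFE FS; case: (set_0Vmem F) => [->|[f fF]]; first by rewrite cards0.
  have lt : (#|F| < #|sum_set (lcas t1 S) (lcas t2 S)|)%N.
    have FW e : e \in F -> (clade_src t1 e \in sum_set (lcas t1 S) (lcas t2 S)) &&
                           (clade_tgt t2 e \in sum_set (lcas t1 S) (lcas t2 S)).
      move=> eF; rewrite !in_set /=; apply/andP; split; apply/imsetP; exists e => //;
        by rewrite inE (simE e (subsetP sFE _ eF)) eqxx FS // leafset_full ?subsetT.
    apply: (card_forest FW).
      by apply/set0Pn; exists (clade_src t1 f); case/andP: (FW _ fF).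
    move=> e eF; apply: contra (forest _ (subsetP sFE _ eF)).
    by apply: sub_adj; exact: setSD.
  move: lt (card_lcas S (uniq_full b1)) (card_lcas S (uniq_full b2)).
  by rewrite card_sum_set !leafset_full // setIT; card_lia.
split=> //; apply/eqP; rewrite eqn_leq; apply/andP; split.
  have := sp setT E; rewrite cardsT card_ord; apply=> // e _; exact: subsetT.
have FW e : e \in E -> (clade_src t1 e \in clade_vertices t1 t2) &&
                       (clade_tgt t2 e \in clade_vertices t1 t2).
  by move=> eE; apply: edge_clade_vertices; rewrite ?leafset_full ?subsetT ?simE.
have := card_connected FW conn; have := card_clade_vertices b1 b2; card_lia.
Qed.

(** * Grafting a leaf and following Henneberg moves *)

Fixpoint graft x u t : btree 'I_n :=
  match t with
  | BLeaf y => if y == u then BNode (BLeaf u) (BLeaf x) else BLeaf y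
  | BNode l r => BNode (graft x u l) (graft x u r)
  end.

(** This is the renaming of old clades under grafting; the only other clade of the grafted tree is
    {u, x}. *)
Definition enlarge x u c := if u \in c then x |: c else c.

Lemma leafset_graft x u t : leafset (graft x u t) = enlarge x u (leafset t).
Proof.
elim: t => [y|l IHl r IHr] /=.
  rewrite /enlarge inE /= inE eq_sym; case: eqVneq => [->|_] //.
  by apply/setP=> z; rewrite !inE orbC.
rewrite !leafsetN IHl IHr /enlarge in_setU.
by case: ifP; case: ifP => //= _ _; apply/setP=> z; rewrite !in_setU ?in_set1;
  case: (z == x); rewrite ?orbT.
Qed.

Lemma uniq_graft x u t : uniq (leaves t) -> x \notin leafset t -> uniq (leaves (graft x u t)).
Proof.
elim: t => [y _|l IHl r IHr ut] /=.
  rewrite inE /= inE => nxy; case: eqVneq => [<-|_] //=.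
  by rewrite inE eq_sym nxy.
have [ul ur dlr] := uniq_leavesN ut; rewrite leafsetN in_setU negb_or => /andP[xl xr].
rewrite cat_uniq IHl // IHr // andbT /=; apply/hasPn=> z zr; apply/negP=> zl.
have {zl} : z \in leafset (graft x u l) by rewrite inE.
have {zr} : z \in leafset (graft x u r) by rewrite inE.
have dis y : y \in leafset l -> y \in leafset r = false.
  by move=> yl; move/pred0P/(_ y): dlr; rewrite /= yl.
rewrite !leafset_graft /enlarge; case: ifP => ur'; case: ifP => ul'.
- by rewrite dis in ur'.
- by case/setU1P=> [->|zr /dis]; [rewrite (negPf xl)|rewrite zr].
- by move=> zr /setU1P[ez|/dis]; [rewrite ez (negPf xr) in zr|rewrite zr].
- by move=> zr /dis; rewrite zr.
Qed.

Lemma clades_graft x u t c : c \in clades (graft x u t) ->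
  c = [set u; x] \/ exists2 d, d \in clades t & c = enlarge x u d.
Proof.
elim: t => [y|l IHl r IHr].
  rewrite /=; case: ifP => // _; rewrite inE => /eqP->; left.
  by apply/setP=> z; rewrite !inE.
rewrite [graft _ _ _]/= !cladesN inE mem_cat => /or3P[/eqP->|/IHl[->|[d dl ->]]|/IHr[->|[d dr ->]]].
- right; exists (leafset (BNode l r)); first by rewrite inE eqxx.
  exact: (leafset_graft x u (BNode l r)).
- by left.
- by right; exists d; rewrite // inE mem_cat dl orbT.
- by left.
- by right; exists d; rewrite // inE mem_cat dr !orbT.
Qed.

(* [e'] is [e] with [u] possibly replaced by its new sibling [x]. *)
Lemma lca_graft x u t e e' : x \notin leafset t -> (2 <= #|e|)%N -> e \subset leafset t ->
  x \notin e -> e' = e \/ u \in e /\ e' = x |: (e :\ u) ->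
  lca (graft x u t) e' = enlarge x u (lca t e).
Proof.
move=> + e2 + xe ee'; elim: t => [y|l IHl r IHr] xt et.
  have := subset_leq_card et.
  have -> : leafset (BLeaf y) = [set y] by apply/setP=> z; rewrite !inE.
  by rewrite cards1 leqNgt e2.
have sub s : x \notin leafset s -> (e' \subset leafset (graft x u s)) = (e \subset leafset s).
  move=> xs; rewrite leafset_graft /enlarge; case: ee' => [->|[ue ->]]; case: ifP => us.
  - by rewrite -subDset (setDidPl _) // disjoint_sym disjoints1.
  - by [].
  - apply/idP/idP=> /subsetP h; apply/subsetP=> z.
      move=> ze; case: (eqVneq z u) => [->//|nzu].
      have := h z; rewrite !in_setU1 in_setD1 nzu ze orbT => /(_ isT) /orP[/eqP ezx|//].
      by rewrite -ezx ze in xe.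
    by rewrite !in_setU1 in_setD1 => /orP[->//|/andP[_ /h ->]]; rewrite orbT.
  - apply/idP/idP=> /subsetP h; first by rewrite (h x) ?setU11 // in xs.
    by rewrite h in us.
move: (xt); rewrite leafsetN in_setU negb_or => /andP[xl xr].
rewrite [graft _ _ _]/= [lca (BNode (graft _ _ _) _) _]/= [lca (BNode l r) _]/= !sub //.
case: ifP => [/(IHl xl)//|_]; case: ifP => [/(IHr xr)//|_].
exact: (leafset_graft x u (BNode l r)).
Qed.

Lemma lca_graft_pair x u t : uniq (leaves t) -> x \notin leafset t -> u \in leafset t ->
  lca (graft x u t) [set x; u] = [set u; x].
Proof.
elim: t => [y _|l IHl r IHr ut] xt.
  rewrite inE /= inE => /eqP euy; move: xt; rewrite -euy eqxx inE /= inE => nxu.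
  rewrite !ifN; first by apply/setP=> z; rewrite !inE.
    by rewrite subUset !sub1set !inE (eq_sym u) (negPf nxu) andbF.
  by rewrite subUset !sub1set !inE (negPf nxu).
have [ul ur dlr] := uniq_leavesN ut.
move: xt; rewrite leafsetN !in_setU negb_or => /andP[xl xr].
have sub s : x \notin leafset s -> ([set x; u] \subset leafset (graft x u s)) = (u \in leafset s).
  move=> xs; rewrite leafset_graft /enlarge subUset !sub1set; case: ifP => [us|->]; last by rewrite andbF.
  by rewrite setU11 in_setU1 us orbT.
rewrite [graft _ _ _]/= [lca _ _]/= !sub //.
by case: ifP => [/(IHl ul xl)//|_] /= ur'; rewrite ur' IHr.
Qed.

Definition coherent t1 t2 E (phi : {set 'I_n} + {set 'I_n} -> bool) :=
  forall e, e \in E -> phi (clade_src t1 e) = phi (clade_tgt t2 e).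

(* A graph is connected iff every 2-colouring of its vertices that is constant
   along edges is constant; this form survives the renaming of clades. *)
Definition clade_connected t1 t2 E := forall phi, coherent t1 t2 E phi ->
  {in clade_vertices t1 t2 &, forall p q, phi p = phi q}.

(** A colouring of the new graph is pulled back to the old clades through their renaming. The edge
    xu ties the new clade of the first tree to c2(uv), and xv ties that of the second to c1(uv). A
    further edge xw acts as a link between c1(uw) and c2(vw), which the hypothesis on colourings may
    use. *)
Lemma clade_connected_graft t1 t2 E E' x u v : 
  uniq (leaves t1) -> uniq (leaves t2) -> leafset t1 = leafset t2 ->
  u \in leafset t1 -> v \in leafset t1 -> u != v -> x \notin leafset t1 ->
  (forall e, e \in E -> [&& #|e| == 2%N, e \subset leafset t1 & e \in E']) ->
  [set x; u] \in E' -> [set x; v] \in E' ->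
  (forall phi, coherent t1 t2 E phi ->
    (forall w, [set x; w] \in E' -> w \in leafset t1 -> w != u -> w != v ->
       phi (clade_src t1 [set u; w]) = phi (clade_tgt t2 [set v; w])) ->
    {in clade_vertices t1 t2 &, forall p q, phi p = phi q}) ->
  clade_connected (graft x u t1) (graft x v t2) E'.
Proof.
move=> u1 u2 e12 ul vl nuv xl EE' xu xv conn phi' coh'.
have ul2 : u \in leafset t2 by rewrite -e12.
have vl2 : v \in leafset t2 by rewrite -e12.
have xl2 : x \notin leafset t2 by rewrite -e12.
pose phi p := match p with inl c => phi' (inl (enlarge x u c))
                         | inr c => phi' (inr (enlarge x v c)) end.
have lca_swap t a w : x \notin leafset t -> a \in leafset t -> w \in leafset t -> a != w ->
    lca (graft x a t) [set x; w] = enlarge x a (lca t [set a; w]).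
  move=> xt at_ wt naw; apply: lca_graft => //.
  - by rewrite cards2 naw.
  - by rewrite subUset !sub1set at_.
  - by rewrite !inE negb_or; apply/andP; split; apply: contraNneq xt => ->.
  - right; split; first by rewrite !inE eqxx.
    by rewrite setU1K // inE.
have coh : coherent t1 t2 E phi.
  move=> e /EE'/and3P[/eqP e2 el /coh']; rewrite /clade_src /clade_tgt /=.
  have xe : x \notin e by apply: contra xl; exact: subsetP el x.
  by rewrite !(@lca_graft _ _ _ e e) ?e2 -?e12 //; left.
have const := conn _ coh _.
have link w : [set x; w] \in E' -> w \in leafset t1 -> w != u -> w != v ->
    phi (clade_src t1 [set u; w]) = phi (clade_tgt t2 [set v; w]).
  move=> /coh' xw wl nwu nwv; rewrite /phi /=.
  by move: xw; rewrite /clade_src /clade_tgt !lca_swap -?e12 // eq_sym.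
have {conn const} const := const link.
have uv2 : (2 <= #|[set u; v]|)%N by rewrite cards2 nuv.
have uvl : [set u; v] \subset leafset t1 by rewrite subUset !sub1set ul.
have uvl2 : [set u; v] \subset leafset t2 by rewrite -e12.
have /andP[suv tuv] := edge_clade_vertices uv2 uvl uvl2.
have const' p : p \in clade_vertices (graft x u t1) (graft x v t2) ->
    phi' p = phi (clade_src t1 [set u; v]).
  case: p => c; rewrite in_set in_set => /clades_graft[->|[d dt ->]].
  - have := coh' _ xu; rewrite /clade_src /clade_tgt lca_graft_pair // => ->.
    rewrite lca_swap // 1?eq_sym // setUC; exact: (const _ _ tuv suv).
  - have dv : inl d \in clade_vertices t1 t2 by rewrite !in_set.
    exact: (const _ _ dv suv).
  - have := coh' _ xv; rewrite /clade_src /clade_tgt lca_graft_pair // => <-.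
    by rewrite lca_swap.
  have dv : inr d \in clade_vertices t1 t2 by rewrite !in_set.
  exact: (const _ _ dv suv).
by move=> p q pv qv; rewrite !const'.
Qed.

Lemma henneberg_laman_counts (V : {set 'I_n}) E : henneberg V E ->
  [/\ (2 <= #|V|)%N, forall e, e \in E -> (#|e| == 2%N) && (e \subset V) & (#|E| + 3 = 2 * #|V|)%N].
Proof.
elim=> {V E} [a b nab|V E x a b _ [V2 EV cE] xV aV bV nab|V E x i j k _ [V2 EV cE] xV ijE kV nki nkj].
- by rewrite cards1 cards2 nab; split=> // e; rewrite inE => /eqP->; rewrite cards2 nab subxx.
- have new y : y \in V -> (#|[set x; y]| == 2%N) && ([set x; y] \subset x |: V).
    move=> yV; rewrite cards2 subUset !sub1set !inE eqxx yV orbT !andbT.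
    by rewrite (_ : x != y) //; apply: contraNneq xV => ->.
  have xE y : [set x; y] \notin E.
    by apply/negP=> /EV/andP[_ /subsetP/(_ x)]; rewrite !inE eqxx (negPf xV) => /(_ isT).
  split.
  - by rewrite (leq_trans V2) // subset_leq_card ?subsetUr.
  - move=> e; rewrite !inE => /orP[/orP[]/eqP->|/EV/andP[-> eV]]; try exact: new.
    by rewrite (subset_trans eV) ?subsetUr.
  rewrite -setUA !cardsU1 xV !in_setU1 negb_or !xE andbT.
  suff -> : [set x; a] != [set x; b] by rewrite /=; card_lia.
  by apply: contraNneq nab => /set2_inj -> //; apply: contraNneq xV => <-.
have new y : y \in V -> (#|[set x; y]| == 2%N) && ([set x; y] \subset x |: V).
  move=> yV; rewrite cards2 subUset !sub1set !inE eqxx yV orbT !andbT.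
  by rewrite (_ : x != y) //; apply: contraNneq xV => ->.
have xE y : [set x; y] \notin E :\ [set i; j].
  by apply/negP=> /setD1P[_ /EV/andP[_ /subsetP/(_ x)]]; rewrite !inE eqxx (negPf xV) => /(_ isT).
have /andP[ij2 ijV] := EV _ ijE; move: ijV; rewrite subUset !sub1set => /andP[iV jV].
have nij : i != j by apply: contraTneq ij2 => ->; rewrite setUid cards1.
have inj y z : y \in V -> y != z -> [set x; y] != [set x; z].
  by move=> yV; apply: contraNneq => /set2_inj -> //; apply: contraNneq xV => <-.
split.
- by rewrite (leq_trans V2) // subset_leq_card ?subsetUr.
- move=> e; rewrite in_setU in_setD1 !inE => /orP[/orP[/orP[]|]/eqP->|/andP[_ /EV/andP[-> eV]]]; try exact: new.
  by rewrite (subset_trans eV) ?subsetUr.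
rewrite -!setUA !cardsU1 xV !in_setU1 !negb_or !xE !inj // 1?eq_sym //.
by have := cardsD1 [set i; j] E; rewrite ijE /=; card_lia.
Qed.

Lemma henneberg_clade_connected (V : {set 'I_n}) E : henneberg V E ->
  exists t1 t2, [/\ uniq (leaves t1), uniq (leaves t2), leafset t1 = V, leafset t2 = V
                   & clade_connected t1 t2 E].
Proof.
elim=> {V E} [a b nab|V E x a b hE [t1 [t2 [u1 u2 l1 l2 conn]]] xV aV bV nab
             |V E x i j k hE [t1 [t2 [u1 u2 l1 l2 conn]]] xV ijE kV nki nkj].
- pose t := BNode (BLeaf a) (BLeaf b); have lt : leafset t = [set a; b].
    by apply/setP=> z; rewrite !inE.
  have ut : uniq (leaves t) by rewrite /= inE nab.
  exists t, t; split=> // phi /(_ [set a; b]); rewrite set11 => /(_ isT) coh p q.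
  have eab : lca t [set a; b] = [set a; b].
    apply/eqP; rewrite eqEsubset sub_lca ?cards2 ?nab ?lt // andbT -lt.
    by apply/clades_sub/lca_clade; rewrite ?lt ?cards2 ?nab.
  move: coh; rewrite /clade_src /clade_tgt eab => coh.
  have all_eq o : o \in clade_vertices t t -> phi o = phi (inl [set a; b]).
    by case: o => c; rewrite in_set in_set inE => /eqP->; [rewrite -lt|rewrite coh -lt].
  by move=> /all_eq-> /all_eq->.
- have [V2 EV cE] := henneberg_laman_counts hE.
  exists (graft x a t1), (graft x b t2).
  rewrite !leafset_graft !uniq_graft ?l1 ?l2 // /enlarge aV bV; split=> //.
  apply: (@clade_connected_graft _ _ E); rewrite ?l1 ?l2 //.
  + by move=> e eE; rewrite andbA EV // in_setU eE orbT.
  + by rewrite !inE eqxx.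
  + by rewrite !inE eqxx orbT.
  + by move=> phi coh _; exact: conn.
have [V2 EV cE] := henneberg_laman_counts hE.
have /andP[ij2 ijV] := EV _ ijE; move: ijV; rewrite subUset !sub1set => /andP[iV jV].
have nij : i != j by apply: contraTneq ij2 => ->; rewrite setUid cards1.
set E' := [set [set x; i]; [set x; j]; [set x; k]] :|: _.
suff [u [v [w [nuv [nuw nvw] [xuE xvE euvw] [uV vV wV] link]]]] : exists u v w, [/\ u != v, u != w /\ v != w,
    [/\ [set x; u] \in E', [set x; v] \in E' & [set i; j; k] = [set u; v; w]],
    [/\ u \in V, v \in V & w \in V] &
    forall phi, coherent t1 t2 (E :\ [set i; j]) phi ->
      phi (clade_src t1 [set u; w]) = phi (clade_tgt t2 [set v; w]) ->
      phi (clade_src t1 [set i; j]) = phi (clade_tgt t2 [set i; j])].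
  exists (graft x u t1), (graft x v t2).
  rewrite !leafset_graft !uniq_graft ?l1 ?l2 // /enlarge uV vV; split=> //.
  apply: (@clade_connected_graft _ _ (E :\ [set i; j])); rewrite ?l1 ?l2 //.
  + by move=> e eD; rewrite in_setU eD orbT andbT EV //; case/setD1P: eD.
  move=> phi coh h; apply: conn => e eE; case: (eqVneq e [set i; j]) => [->|ne].
    apply: link => //; apply: h; rewrite // 1?eq_sym //.
    have : w \in [set i; j; k] by rewrite euvw !inE eqxx orbT.
    by rewrite !inE => /orP[/orP[]|]/eqP->; rewrite eqxx ?orbT.
  by apply: coh; rewrite in_setD1 ne.
have /andP[srcV _] : (clade_src t1 [set i; j] \in clade_vertices t1 t2) &&
    (clade_tgt t2 [set i; j] \in clade_vertices t1 t2).
  apply: edge_clade_vertices; rewrite ?l1 ?l2 ?subUset ?sub1set ?iV ?jV //.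
  by rewrite (eqP ij2).
(* [join p q] says that p and q lie in one component of the clade graph without the edge ij, again
   in terms of colourings. *)
pose join p q := forall phi, coherent t1 t2 (E :\ [set i; j]) phi -> phi p = phi q.
have part p : p \in clade_vertices t1 t2 ->
    join (clade_src t1 [set i; j]) p \/ join (clade_tgt t2 [set i; j]) p.
  move=> pv; case: (boolp.EM (join (clade_src t1 [set i; j]) p)); first by left.
  case: (boolp.EM (join (clade_tgt t2 [set i; j]) p)); first by right.
  move=> /boolp.existsNP[psi /boolp.not_implyP[cpsi npsi]].
  move=> /boolp.existsNP[phi /boolp.not_implyP[cphi nphi]].
  (* If p were separated from both ends of ij, this conjunction would be false at both ends, hence
     constant along ij as well, yet true at p, against connectedness of the graph with ij. *)
  pose chi o := (phi o == phi p) && (psi o == psi p).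
  have chi_src : chi (clade_src t1 [set i; j]) = false by rewrite /chi; case: eqP.
  have chi_tgt : chi (clade_tgt t2 [set i; j]) = false by rewrite /chi andbC; case: eqP.
  have cchi : coherent t1 t2 E chi.
    move=> e eE; case: (eqVneq e [set i; j]) => [->|ne]; first by rewrite chi_src chi_tgt.
    by rewrite /chi cphi ?cpsi // in_setD1 ne.
  by have := conn _ cchi _ _ srcV pv; rewrite chi_src /chi !eqxx.
have joinW u v w : join (clade_src t1 [set i; j]) (clade_src t1 [set u; w]) ->
    join (clade_tgt t2 [set i; j]) (clade_tgt t2 [set v; w]) ->
    forall phi, coherent t1 t2 (E :\ [set i; j]) phi ->
      phi (clade_src t1 [set u; w]) = phi (clade_tgt t2 [set v; w]) ->
      phi (clade_src t1 [set i; j]) = phi (clade_tgt t2 [set i; j]).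
  by move=> ju jv phi coh; rewrite -ju // -jv.
have refl p : join p p by [].
have nik : i != k by rewrite eq_sym.
have njk : j != k by rewrite eq_sym.
have nji : j != i by rewrite eq_sym.
have Ei : [set x; i] \in E' by rewrite !inE eqxx.
have Ej : [set x; j] \in E' by rewrite !inE eqxx orbT.
have Ek : [set x; k] \in E' by rewrite !inE eqxx !orbT.
have pairV a b : a \in V -> b \in V -> a != b ->
    (clade_src t1 [set a; b] \in clade_vertices t1 t2) &&
    (clade_tgt t2 [set a; b] \in clade_vertices t1 t2).
  move=> aV bV nab; apply: edge_clade_vertices; first by rewrite cards2 nab.
    by rewrite l1 subUset !sub1set aV.
  by rewrite l2 subUset !sub1set aV.
have /andP[_ jkV] := pairV _ _ jV kV njk; have /andP[ikV _] := pairV _ _ iV kV nik.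
have [jk_src|jk_tgt] := part _ jkV; last first.
  exists i, k, j; split=> //; first by split=> //; rewrite setUAC.
  by apply: joinW => //; rewrite (setUC [set k]).
have [ik_src|ik_tgt] := part _ ikV.
  exists k, j, i; split=> //; first by split=> //; rewrite setUAC -setUA setUC setUAC.
  by apply: joinW; [rewrite (setUC [set k])|rewrite (setUC [set j])].
by exists i, j, k; split=> // phi coh; rewrite -ik_tgt // -jk_src.
Qed.

(** Acyclicity comes from counting: if an edge were not a bridge, deleting it would leave 2n - 2
    clades connected by 2n - 4 edges. *)
Lemma henneberg_trees E : henneberg_graph E ->
  exists t1 t2, [/\ binary_tree_on t1, binary_tree_on t2 & clade_graph_is_tree E t1 t2].
Proof.
move=> hE; have [n2 EV cE] := henneberg_laman_counts hE.
have [t1 [t2 [u1 u2 l1 l2 conn]]] := henneberg_clade_connected hE.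
have full t : uniq (leaves t) -> leafset t = setT -> binary_tree_on t.
  move=> ut lt; apply: uniq_perm; rewrite ?enum_uniq // => x.
  by rewrite mem_enum; have := in_setT x; rewrite -lt inE.
have b1 := full _ u1 l1; have b2 := full _ u2 l2; exists t1, t2; split=> //.
have simE : simple_graph E by move=> e /EV/andP[/eqP].
have EW e : e \in E -> (clade_src t1 e \in clade_vertices t1 t2) &&
                       (clade_tgt t2 e \in clade_vertices t1 t2).
  by move=> eE; apply: edge_clade_vertices; rewrite ?leafset_full ?subsetT ?simE.
have conn' F : (forall phi, coherent t1 t2 F phi -> coherent t1 t2 E phi) ->
    {in clade_vertices t1 t2 &, forall p q,
       connect (adj (clade_src t1) (clade_tgt t2) F) p q}.
  (* The colouring used is reachability from p. *)
  move=> FE p q pv qv; have := conn (connect (adj (clade_src t1) (clade_tgt t2) F) p) _ p q pv qv.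
  rewrite connect0 => <- //; apply: FE => e eF.
  apply: same_connect_r; first exact/sym_connect_sym/adj_sym.
  exact/connect1/adj_edge.
apply/clade_graph_treeP => //; split; first exact: conn'.
move=> e eE; apply/negP=> ce.
have FW f : f \in E :\ e -> (clade_src t1 f \in clade_vertices t1 t2) &&
                           (clade_tgt t2 f \in clade_vertices t1 t2).
  by case/setD1P=> _; exact: EW.
have := card_connected FW; have := cardsD1 e E; have := card_clade_vertices b1 b2.
rewrite eE cardsT card_ord in cE *; move=> h1 h2 h3.
suff : (#|clade_vertices t1 t2| <= #|E :\ e| + 1)%N by card_lia.
apply: h3; apply: conn' => phi coh f fE; case: (eqVneq f e) => [->|ne]; last first.
  by apply: coh; rewrite in_setD1 ne.
case/connectP: ce => p; move: (clade_src t1 e) => s.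
elim: p s => [|q p IH] s /=; first by move=> _ ->.
move=> /andP[/exists_inP[g gE sq] /IH-/[apply] <-].
by have := coh _ gE; case/orP: sq => /andP[/eqP-> /eqP->].
Qed.

End CladeGraphs.

(** * Generic configurations *)

Section RealSequences.
Variable R : realType.
Local Open Scope ring_scope.

Lemma nested_intervals (a b : nat -> R) :
  (forall k, a k <= a k.+1) -> (forall k, b k.+1 <= b k) -> (forall k, a k <= b k) ->
  exists L, forall k, a k <= L <= b k.
Proof.
move=> inca decb ab.
have a_homo : {homo a : i j / (i <= j)%N >-> i <= j} by apply: homo_leq => // ? ? ?; exact: le_trans.
have b_homo : {homo b : i j / (i <= j)%N >-> j <= i}.
  by apply: homo_leq => // ? ? ? h1 h2; exact: le_trans h2 h1.
have ub j : classical_sets.ubound (fun x => exists k, x = a k) (b j).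
  move=> _ [k ->]; apply: le_trans (a_homo k (maxn k j) (leq_maxl _ _)) _.
  exact: le_trans (ab _) (b_homo j _ (leq_maxr _ _)).
have hs : classical_sets.has_sup (fun x => exists k, x = a k) by split; [exists (a 0%N), 0%N|exists (b 0%N)].
exists (sup (fun x => exists k, x = a k)) => k; apply/andP; split.
  by apply: sup_upper_bound => //; exists k.
by apply: ge_sup => //; exists (a 0%N), 0%N.
Qed.

(** Cantor's argument by nested intervals: each step keeps the outer third on the other side of the
    midpoint from [r k]. *)
Lemma exists_avoiding (r : nat -> R) : exists t, forall k, t != r k.
Proof.
pose next (k : nat) (I : R * R) : R * R :=
  let d := (I.2 - I.1) / 3%:R in
  if r k < I.1 + 3%:R / 2%:R * d then (I.1 + 2%:R * d, I.2) else (I.1, I.1 + d).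
pose I := fix I k := if k is k'.+1 then next k' (I k') else (0, 1) : R * R.
have IS k : I k.+1 = next k (I k) by [].
have lt k : (I k).1 < (I k).2.
  elim: k => [|k IH]; first by rewrite /= ltr01.
  by rewrite IS /next; case: ifP => _ /=; lra.
have [|||L hL] := @nested_intervals (fun k => (I k).1) (fun k => (I k).2).
- by move=> k; have := lt k; rewrite IS /next; case: ifP => _ /=; lra.
- by move=> k; have := lt k; rewrite IS /next; case: ifP => _ /=; lra.
- by move=> k; exact: ltW.
exists L => k; apply/eqP=> eL; have ltk := lt k; have := hL k.+1.
by rewrite IS /next -eL; case: ltP => /= ? /andP[]; lra.
Qed.

Lemma poly_roots_seq (F : fieldType) (Q : {poly F}) : Q != 0 ->
  exists s : seq F, forall t, root Q t -> t \in s.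
Proof.
move=> Q0; have [k] := ubnP (size Q); elim: k Q Q0 => // k IH Q Q0 szQ.
case: (boolp.EM (exists r, root Q r)) => [[r rQ]|nr]; last first.
  by exists [::] => t rt; case: nr; exists t.
have /factor_theorem[Q' eQ] := rQ.
have Q'0 : Q' != 0 by apply: contraNneq Q0 => Q'0; rewrite eQ Q'0 mul0r.
have [|s hs] := IH _ Q'0.
  by move: szQ; rewrite eQ size_Mmonic ?monicXsubC // size_XsubC addn2.
by exists (r :: s) => t; rewrite eQ rootM root_XsubC inE orbC => /orP[->//|/hs ->]; rewrite orbT.
Qed.

(** Countably many nonzero polynomials have countably many roots altogether; they are listed through
    codes of pairs (polynomial, index of root), with 0 at other codes. *)
Lemma exists_nonroot (Q : nat -> {poly R}) : exists t, forall k, Q k != 0 -> ~~ root (Q k) t.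
Proof.
have ex_s k : exists s : seq R, Q k != 0 -> forall t, root (Q k) t -> t \in s.
  by case: (eqVneq (Q k) 0) => [_|/poly_roots_seq[s hs]]; [exists [::]|exists s].
have [s hs] := boolp.choice ex_s.
have [t ht] := exists_avoiding (fun j => if unpickle j is Some (k, i) then (s k)`_i else 0).
exists t => k Qk; apply/negP=> /(hs k Qk) ts.
by have := ht (pickle (k, index t (s k))); rewrite pickleK nth_index ?eqxx.
Qed.

Definition rat_eval n (v : 'I_n -> R) (P : {mpoly rat[n]}) : R :=
  (map_mpoly (ratr : rat -> R) P).@[v].

HB.instance Definition _ n v := GRing.RMorphism.copy (@rat_eval n v)
  (meval v \o map_mpoly (ratr : rat -> R)).

Lemma rat_evalX n (v : 'I_n -> R) i : rat_eval v 'X_i = v i.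
Proof. by rewrite /rat_eval map_mpolyX mevalXU. Qed.

Lemma rat_evalC n (v : 'I_n -> R) c : rat_eval v c%:MP = ratr c.
Proof. by rewrite /rat_eval map_mpolyC mevalC. Qed.

Lemma rat_evalE n (v : 'I_n -> R) P :
  rat_eval v P = \sum_(m <- msupp P) ratr P@_m * \prod_i v i ^+ m i.
Proof.
rewrite {1}[P]mpolyE raddf_sum /=; apply: eq_bigr => m _.
by rewrite /rat_eval map_mpolyZ map_mpolyX mevalZ mevalX.
Qed.

(** This reads every coefficient of P off [muni P], whence [muni] is injective. *)
Lemma coef_muni (A : nzRingType) n (P : {mpoly A[n.+1]}) (m : 'X_{1..n.+1}) :
  ((muni P)`_(m ord_max))@_[multinom m (widen_ord (leqnSn n) i) | i < n] = P@_m.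
Proof.
rewrite muniE coef_sum raddf_sum /=.
pose low (m' : 'X_{1..n.+1}) := [multinom m' (widen_ord (leqnSn n) i) | i < n].
have h m' : ((P@_m' *: 'X_[low m'] *: 'X^(m' ord_max))`_(m ord_max))@_(low m) = P@_m' * (m' == m)%:R.
  rewrite coefZ coefXn mulr_natr mcoeffMn mcoeffZ mcoeffX -mulrnAr.
  case: (eqVneq m' m) => [->|nm]; first by rewrite !eqxx.
  case: eqP => [em|_]; last by rewrite ?mulr0n ?mul0rn !mulr0.
  case: eqP => [el|_]; last by rewrite ?mulr0n ?mul0rn !mulr0.
  case/eqP: nm; apply/mnmP => i; case: (unliftP ord_max i) => [j ->|->] //.
  have /mnmP/(_ j) := em; rewrite /low !mnmE.
  by have -> : widen_ord (leqnSn n) j = lift ord_max j by apply/val_inj; exact/esym/lift_max.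
rewrite (eq_bigr _ (fun m' _ => h m')).
case: (boolP (m \in msupp P)) => mP.
  rewrite (bigD1_seq m) ?msupp_uniq //= eqxx mulr1 big1 ?addr0 // => m' /negPf->.
  by rewrite mulr0.
rewrite big_seq big1 ?(memN_msupp_eq0 mP) // => m' m'P.
by case: eqP => [em|_]; [rewrite em (negPf mP) in m'P|rewrite mulr0].
Qed.

Lemma muni_eq0 (A : nzRingType) n (P : {mpoly A[n.+1]}) : muni P = 0 -> P = 0.
Proof. by move=> P0; apply/mpolyP=> m; rewrite -coef_muni P0 coef0 !mcoeff0. Qed.

Lemma rat_eval_muni n (v : 'I_n.+1 -> R) P :
  rat_eval v P = (map_poly (rat_eval (v \o widen_ord (leqnSn n))) (muni P)).[v ord_max].
Proof.
rewrite rat_evalE muniE raddf_sum horner_sum; apply: eq_bigr => m _ /=.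
rewrite map_polyZ map_polyXn hornerZ hornerXn big_ord_recr /= mulrA; congr (_ * _).
rewrite -mul_mpolyC rmorphM /= rat_evalC; congr (_ * _).
rewrite /rat_eval map_mpolyX mevalX; apply: eq_bigr => i _.
by rewrite mnmE.
Qed.

(** Coordinates are added one at a time. After substituting v, a nonzero rational polynomial becomes
    a nonzero real polynomial in the last variable, because v is independent; there are countably
    many of these, so some t is a root of none. *)
Lemma exists_algebraically_independent n :
  exists v : 'I_n -> R, forall P : {mpoly rat[n]}, P != 0 -> rat_eval v P != 0.
Proof.
elim: n => [|n [v hv]].
  exists (fun=> 0) => P P0; rewrite (_ : P = (P@_0%MM)%:MP).
    rewrite rat_evalC fmorph_eq0; apply: contraNneq P0 => P0; apply/eqP/mpolyP=> m.
    by rewrite mcoeff0 -P0; congr (P@__); apply/mnmP=> -[].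
  apply/mpolyP=> m; rewrite mcoeffC (_ : 0%MM = m) ?eqxx ?mulr1 //.
  by apply/mnmP=> -[].
(* Lists of coefficients and monomials can be enumerated, which makes the polynomials countable. *)
pose decode (s : seq (rat * 'X_{1..n.+1})) : {mpoly rat[n.+1]} := \sum_(u <- s) u.1 *: 'X_[u.2].
have decodeP P : exists s, decode s = P.
  exists [seq (P@_m, m) | m <- msupp P].
  by rewrite /decode big_map [RHS]mpolyE.
pose Q k := if unpickle k is Some s then map_poly (rat_eval v) (muni (decode s)) else 0.
have [t ht] := exists_nonroot Q.
pose w (i : 'I_n.+1) := if unlift ord_max i is Some j then v j else t.
exists w => P P0; have [s eP] := decodeP P.
have wv : w \o widen_ord (leqnSn n) =1 v.
  move=> j /=; rewrite /w (_ : widen_ord _ j = lift ord_max j) ?liftK //.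
  by apply/val_inj; exact/esym/lift_max.
have eQ : Q (pickle s) = map_poly (rat_eval (w \o widen_ord (leqnSn n))) (muni P).
  rewrite /Q pickleK eP; apply: eq_map_poly => q.
  by apply: meval_eq => i; rewrite wv.
rewrite rat_eval_muni -eQ /w unlift_none; apply: (ht (pickle s)).
rewrite /Q pickleK eP; apply: contraNneq P0 => Q0; apply/eqP/muni_eq0/polyP=> d.
rewrite coef0; apply: contraTeq isT => /hv.
by rewrite -(coef_map_id0 _ _ (rmorph0 (rat_eval v))) Q0 coef0 eqxx.
Qed.

(** Generic rigidity quantifies over generic configurations, so refuting it needs one to exist. *)
Lemma exists_generic_config n : exists p : 'I_n -> R * R, generic_config p.
Proof.
have [v hv] := exists_algebraically_independent (n + n).
exists (fun u => (v (lshift n u), v (rshift n u))) => P P0; have := hv P P0.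
congr (_ != 0); apply: meval_eq => i; rewrite /coords.
by case: splitP => j ei; congr (v _); apply/val_inj.
Qed.

End RealSequences.

(** * The rigidity matrix *)

Section RigidityMatrix.
Local Open Scope ring_scope.

Lemma row_free_ker0 (F : fieldType) m k (M : 'M[F]_(m, k)) :
  row_free M <-> (forall y : 'rV_m, y *m M = 0 -> y = 0).
Proof.
split=> [free y yM|ker0]; first by apply: (row_free_inj free); rewrite yM mul0mx.
rewrite -kermx_eq0; apply/eqP/row_matrixP=> r.
by rewrite row0; apply: ker0; rewrite -row_mul mulmx_ker row0.
Qed.

Variable n : nat.
Implicit Types (e S : {set 'I_n}) (F G : {set {set 'I_n}}).

(** For e = {a, b} and u = a this is f a - f b. Summing over all of e avoids choosing an order of
    the ends, as the term w = u vanishes. *)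
Definition edge_coef (A : zmodType) (f : 'I_n -> A) e u : A :=
  if u \in e then \sum_(w in e) (f u - f w) else 0.

Lemma edge_coefl (A : zmodType) (f : 'I_n -> A) a b :
  a != b -> edge_coef f [set a; b] a = f a - f b.
Proof.
by move=> nab; rewrite /edge_coef set21 big_setU1 ?inE //= big_set1 subrr add0r.
Qed.

Lemma edge_coefr (A : zmodType) (f : 'I_n -> A) a b :
  a != b -> edge_coef f [set a; b] b = f b - f a.
Proof. by move=> nab; rewrite setUC edge_coefl // eq_sym. Qed.

Lemma sum_edge_coef (A : comPzRingType) (f h : 'I_n -> A) N (s : 'I_N -> 'I_n) a b :
  injective s -> a != b -> (exists j, s j = a) -> (exists j, s j = b) ->
  \sum_j edge_coef f [set a; b] (s j) * h (s j) = (f a - f b) * (h a - h b).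
Proof.
move=> injs nab [ja eja] [jb ejb].
have njab : ja != jb by apply: contraNneq nab => ej; rewrite -eja -ejb ej.
rewrite (bigD1 ja) //= (bigD1 jb) 1?eq_sym //= big1 => [|j /andP[nja njb]].
  rewrite addr0 eja ejb edge_coefl // edge_coefr //; ring.
rewrite /edge_coef ifF ?mul0r // !inE -eja -ejb !(inj_eq injs).
by rewrite (negPf nja) (negPf njb).
Qed.

(** The map s selects the vertices that index columns: all of them with the identity, or those of a
    subset S with its enumeration. The two blocks hold the two coordinates. *)
Definition rigidity_mx (A : zmodType) (f g : 'I_n -> A) F N (s : 'I_N -> 'I_n) : 'M[A]_(#|F|, N + N) :=
  row_mx (\matrix_(i, j) edge_coef f (enum_val i) (s j))
         (\matrix_(i, j) edge_coef g (enum_val i) (s j)).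

Lemma map_rigidity_mx (A B : pzRingType) (phi : {rmorphism A -> B}) (f g : 'I_n -> A) F N
    (s : 'I_N -> 'I_n) :
  map_mx phi (rigidity_mx f g F s) = rigidity_mx (phi \o f) (phi \o g) F s.
Proof.
have phiE h e u : phi (edge_coef h e u) = edge_coef (phi \o h) e u.
  rewrite /edge_coef; case: ifP => _; last exact: rmorph0.
  by rewrite rmorph_sum; apply: eq_bigr => w _; rewrite rmorphB.
by rewrite map_row_mx; congr row_mx; apply/matrixP=> i j; rewrite !mxE phiE.
Qed.

Variable R : realType.
Implicit Types (p q : 'I_n -> R * R).

Definition rig F p N (s : 'I_N -> 'I_n) := rigidity_mx (fun u => (p u).1) (fun u => (p u).2) F s.

(** The only equilibrium stress is zero. This is independence of the rows of the rigidity matrix, in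
    a form that does not depend on the enumeration of edges or columns. *)
Definition stress_free F p := forall omega : {set 'I_n} -> R,
  (forall u, \sum_(e in F) omega e * edge_coef (fun w => (p w).1) e u = 0) ->
  (forall u, \sum_(e in F) omega e * edge_coef (fun w => (p w).2) e u = 0) ->
  forall e, e \in F -> omega e = 0.

Lemma stress_free_row_free F p N (s : 'I_N -> 'I_n) :
  (forall e u, e \in F -> u \in e -> exists j, s j = u) ->
  stress_free F p -> row_free (rig F p s).
Proof.
move=> cov sf; apply/row_free_ker0 => y.
rewrite mul_mx_row -[0 in RHS]hsubmxK => /eq_row_mx[]; rewrite !linear0 => y1 y2.
pose omega e : R := \sum_(i | enum_val i == e) y 0 i.
have omegaE i : omega (enum_val i) = y 0 i.
  by rewrite /omega (big_pred1 i) // => j; rewrite (inj_eq enum_val_inj).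
have sum0 (f : 'I_n -> R) u : (y *m (\matrix_(i, j) edge_coef f (enum_val i) (s j))) = 0 ->
    \sum_(e in F) omega e * edge_coef f e u = 0.
  move=> yf; case: (boolP [exists e in F, u \in e]) => [/exists_inP[e eF ue]|/exists_inPn nu].
    have [j ej] := cov e u eF ue.
    transitivity ((y *m (\matrix_(i, j) edge_coef f (enum_val i) (s j))) 0 j); last by rewrite yf mxE.
    rewrite [LHS]big_enum_val [RHS]mxE; apply: eq_bigr => i _; rewrite mxE ej.
    by rewrite omegaE.
  by rewrite big1 // => e /nu /negPf ue; rewrite /edge_coef ue mulr0.
have om0 := sf omega (fun u => sum0 _ u y1) (fun u => sum0 _ u y2).
by apply/rowP=> i; rewrite -omegaE om0 ?enum_valP // mxE.
Qed.

Lemma row_free_stress_free F p : row_free (rig F p (@id 'I_n)) -> stress_free F p.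
Proof.
move=> free omega h1 h2 e eF; pose y : 'rV[R]_#|F| := \row_i omega (enum_val i).
have : y *m rig F p id = 0.
  rewrite mul_mx_row (_ : 0 = row_mx 0 0); last by rewrite row_mx0.
  by congr row_mx; apply/rowP=> u; rewrite !mxE; [rewrite -[RHS](h1 u)|rewrite -[RHS](h2 u)];
    rewrite [RHS]big_enum_val; apply: eq_bigr => i _; rewrite !mxE.
rewrite -(mul0mx _ (rig F p id)) => /(row_free_inj free) /rowP/(_ (enum_rank_in eF e)).
by rewrite !mxE enum_rankK_in.
Qed.

Lemma stress_free_sub F G p : F \subset G -> stress_free G p -> stress_free F p.
Proof.
move=> /subsetP sFG sf omega h1 h2 e eF.
have ext (f : 'I_n -> R) u : \sum_(e in F) omega e * edge_coef f e u = 0 ->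
    \sum_(e in G) (if e \in F then omega e else 0) * edge_coef f e u = 0.
  move=> h; rewrite -[RHS]h [RHS]big_mkcond [LHS]big_mkcond /=; apply: eq_bigr => d _.
  case: (boolP (d \in F)) => [/sFG->//|_]; by rewrite mul0r if_same.
have := sf (fun e => if e \in F then omega e else 0) (fun u => ext _ u (h1 u)) (fun u => ext _ u (h2 u)).
by move=> /(_ e (sFG _ eF)); rewrite eF.
Qed.

(** Over the reals, the rows of M are independent iff the Gram determinant of M is nonzero. This
    determinant is a rational polynomial in the coordinates; being nonzero at p, it is a nonzero
    polynomial and cannot vanish at a generic q. *)
Lemma generic_stress_free F p q : stress_free F p -> generic_config q -> stress_free F q.
Proof.
pose gram (A : comPzRingType) (f g : 'I_n -> A) :=
  \det (rigidity_mx f g F (@id 'I_n) *m (rigidity_mx f g F (@id 'I_n))^T).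
have gramP r : row_free (rig F r (@id 'I_n)) = (gram R (fun u => (r u).1) (fun u => (r u).2) != 0).
  rewrite -unitfE -unitmxE -/(rig F r _); set M := rig _ _ _.
  apply/idP/idP=> [free|]; last first.
    rewrite -row_free_unit => /row_free_ker0 ker0; apply/row_free_ker0 => y yM.
    by apply: ker0; rewrite mulmxA yM mul0mx.
  rewrite -row_free_unit; apply/row_free_ker0 => y yMM.
  (* This scalar is the sum of the squares of the entries of yM. *)
  have yM0 : y *m M *m (y *m M)^T = 0 by rewrite trmx_mul mulmxA -(mulmxA y) yMM mul0mx.
  have {yMM}yM0 : y *m M = 0 *m M.
    rewrite mul0mx; apply/rowP=> j; have /rowP/(_ 0) := yM0; rewrite mxE [RHS]mxE => /eqP.
    rewrite psumr_eq0 => [|k _]; last by rewrite [(_ ^T) _ _]mxE -expr2 sqr_ge0.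
    by move=> /allP/(_ j (mem_index_enum _)); rewrite [(_ ^T) _ _]mxE -expr2 sqrf_eq0 => /eqP->; rewrite mxE.
  exact: row_free_inj free _ _ yM0.
move=> sf gen; apply: row_free_stress_free; rewrite gramP.
pose P : {mpoly rat[n + n]} := gram _ (fun u => 'X_(lshift n u)) (fun u => 'X_(rshift n u)).
have evalP r : rat_eval (coords r) P = gram R (fun u => (r u).1) (fun u => (r u).2).
  have e1 : rat_eval (coords r) \o (fun u => 'X_(lshift n u)) = (fun u => (r u).1).
    by apply: boolp.funext => u /=; rewrite rat_evalX /coords (unsplitK (inl u)).
  have e2 : rat_eval (coords r) \o (fun u => 'X_(rshift n u)) = (fun u => (r u).2).
    by apply: boolp.funext => u /=; rewrite rat_evalX /coords (unsplitK (inr u)).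
  by rewrite /P /gram -det_map_mx map_mxM -map_trmx map_rigidity_mx e1 e2.
rewrite -evalP; apply: gen; apply: contraTneq (stress_free_row_free _ sf) => [|e u _ _]; last by exists u.
by move=> P0; rewrite gramP -evalP P0 rmorph0 eqxx.
Qed.

End RigidityMatrix.

(** * Henneberg graphs are generically independent *)

Section HennebergStress.
Variables (n : nat) (R : realType).
Local Open Scope ring_scope.
Implicit Types (e S V : {set 'I_n}) (E F G : {set {set 'I_n}}) (p q : 'I_n -> R * R).

Lemma generic_eval_neq0 p (P : {mpoly rat[n + n]}) : generic_config p ->
  (exists q, rat_eval (coords q) P != 0) -> rat_eval (coords p) P != 0.
Proof. by move=> gen [q nq]; apply: gen; apply: contraNneq nq => ->; rewrite rmorph0. Qed.

Lemma rat_eval_fst p u : rat_eval (coords p) 'X_(lshift n u) = (p u).1.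
Proof. by rewrite rat_evalX /coords (unsplitK (inl u)). Qed.

Lemma rat_eval_snd p u : rat_eval (coords p) 'X_(rshift n u) = (p u).2.
Proof. by rewrite rat_evalX /coords (unsplitK (inr u)). Qed.

Lemma generic_inj p : generic_config p -> injective p.
Proof.
move=> gen u v epuv; apply/eqP; apply: contraT => nuv.
pose P : {mpoly rat[n + n]} := 'X_(lshift n u) - 'X_(lshift n v).
have := @generic_eval_neq0 p P gen; rewrite rmorphB /= !rat_eval_fst epuv subrr eqxx.
apply; exists (fun w => ((w == u)%:R, 0)); rewrite rmorphB /= !rat_eval_fst /=.
by rewrite eqxx (eq_sym v) (negPf nuv) subr0 oner_eq0.
Qed.

(** Twice the signed area of the triangle abc, so nonzero exactly when the points are not
    collinear. *)
Definition area (a b c : R * R) := (a.1 - c.1) * (b.2 - c.2) - (b.1 - c.1) * (a.2 - c.2).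

Lemma linear_eq2 (a b c : R * R) s t : area a b c != 0 ->
  s * (c.1 - a.1) + t * (c.1 - b.1) = 0 -> s * (c.2 - a.2) + t * (c.2 - b.2) = 0 ->
  s = 0 /\ t = 0.
Proof.
move=> area0 e1 e2; split; apply: (mulIf area0); rewrite mul0r /area.
  transitivity ((s * (c.1 - a.1) + t * (c.1 - b.1)) * (c.2 - b.2) -
                (s * (c.2 - a.2) + t * (c.2 - b.2)) * (c.1 - b.1)); first by ring.
  by rewrite e1 e2 !mul0r subr0.
transitivity ((s * (c.2 - a.2) + t * (c.2 - b.2)) * (c.1 - a.1) -
              (s * (c.1 - a.1) + t * (c.1 - b.1)) * (c.2 - a.2)); first by ring.
by rewrite e1 e2 !mul0r subr0.
Qed.

Lemma generic_area p u v w : generic_config p -> u != v -> u != w -> v != w ->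
  area (p u) (p v) (p w) != 0.
Proof.
move=> gen nuv nuw nvw.
pose P : {mpoly rat[n + n]} :=
  ('X_(lshift n u) - 'X_(lshift n w)) * ('X_(rshift n v) - 'X_(rshift n w)) -
  ('X_(lshift n v) - 'X_(lshift n w)) * ('X_(rshift n u) - 'X_(rshift n w)).
have PE q : rat_eval (coords q) P = area (q u) (q v) (q w).
  by rewrite /P rmorphB !rmorphM !rmorphB /= !rat_eval_fst !rat_eval_snd.
rewrite -PE; apply: generic_eval_neq0 gen _.
exists (fun z => ((z == u)%:R, (z == v)%:R)); rewrite PE /area /= !eqxx.
rewrite (eq_sym v) (eq_sym w u) (eq_sym w v) (negPf nuv) (negPf nuw) (negPf nvw).
by rewrite !subr0 mulr0 subr0 mulr1 oner_eq0.
Qed.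

Lemma edge_coefE (f : 'I_n -> R) a b u : a != b -> edge_coef f [set a; b] u =
  if u == a then f a - f b else if u == b then f b - f a else 0.
Proof.
move=> nab; case: eqP => [->|/eqP nua]; first exact: edge_coefl.
case: eqP => [->|/eqP nub]; first exact: edge_coefr.
by rewrite /edge_coef !inE (negPf nua) (negPf nub).
Qed.

(** For move (i), equilibrium at x involves two independent directions, so both new coefficients
    vanish. For move (ii), x is put at the midpoint of i and j: equilibrium at x kills the
    coefficient of xk and makes those of xi and xj equal, so the two half edges act as the edge ij
    and the stress descends to the old graph. *)
Lemma henneberg_stress_free V E : henneberg V E -> exists p, stress_free E p.
Proof.
elim=> {V E} [a b nab|V E x a b hE [p0 sf0] xV aV bV nab|V E x i j k hE [p0 sf0] xV ijE kV nki nkj].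
- exists (fun u => ((u == a)%:R, 0)) => omega h _ e; rewrite inE => /eqP->.
  have := h a; rewrite big_set1 edge_coefl //= eqxx (eq_sym b) (negPf nab) subr0 mulr1.
  exact.
- have [p gen] := exists_generic_config R n.
  have sf := generic_stress_free sf0 gen; exists p => omega h1 h2.
  have [V2 EV _] := henneberg_laman_counts hE.
  have nxa : x != a by apply: contraNneq xV => ->.
  have nxb : x != b by apply: contraNneq xV => ->.
  have xE y : [set x; y] \notin E.
    by apply/negP=> /EV/andP[_ /subsetP/(_ x)]; rewrite set21 (negPf xV) => /(_ isT).
  have nxaxb : [set x; a] != [set x; b] by apply: contraNneq nab => /set2_inj -> //; rewrite eq_sym.
  have split_sum (f : 'I_n -> R) u : \sum_(e in [set [set x; a]; [set x; b]] :|: E) omega e * edge_coef f e u =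
      omega [set x; a] * edge_coef f [set x; a] u +
      (omega [set x; b] * edge_coef f [set x; b] u + \sum_(e in E) omega e * edge_coef f e u).
    by rewrite -setUA !big_setU1 // ?in_setU1 ?negb_or ?nxaxb ?xE.
  have atx (f : 'I_n -> R) : \sum_(e in E) omega e * edge_coef f e x = 0.
    rewrite big1 // => e /EV/andP[_ eV]; rewrite /edge_coef ifN ?mulr0 //.
    by apply: contra xV; exact: subsetP eV x.
  have := h1 x; rewrite split_sum atx addr0 !edge_coefl // => e1.
  have := h2 x; rewrite split_sum atx addr0 !edge_coefl // => e2.
  have area0 : area (p a) (p b) (p x) != 0 by apply: generic_area; rewrite // eq_sym.
  have [oa ob] := linear_eq2 area0 e1 e2.
  move=> e; rewrite !inE => /orP[/orP[]/eqP->//|]; apply: sf => u.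
    by have := h1 u; rewrite split_sum oa ob !mul0r !add0r.
  by have := h2 u; rewrite split_sum oa ob !mul0r !add0r.
have [q gen] := exists_generic_config R n.
have sf := generic_stress_free sf0 gen.
have [V2 EV _] := henneberg_laman_counts hE.
have /andP[ij2 ijV] := EV _ ijE; move: ijV; rewrite subUset !sub1set => /andP[iV jV].
have nij : i != j by apply: contraTneq ij2 => ->; rewrite setUid cards1.
have nx y : y \in V -> x != y by move=> yV; apply: contraNneq xV => ->.
pose move (f : 'I_n -> R) u := if u == x then (f i + f j) / 2 else f u.
pose p u := (move (fun w => (q w).1) u, move (fun w => (q w).2) u).
have xE y : [set x; y] \notin E :\ [set i; j].
  by apply/negP=> /setD1P[_ /EV/andP[_ /subsetP/(_ x)]]; rewrite set21 (negPf xV) => /(_ isT).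
have inj y z : y \in V -> y != z -> [set x; y] != [set x; z].
  by move=> yV; apply: contraNneq => /set2_inj -> //; rewrite eq_sym nx.
have moveV (f : 'I_n -> R) y : y \in V -> move f y = f y.
  by move=> /nx; rewrite /move eq_sym => /negPf->.
have moveE (f : 'I_n -> R) e u : e \in E -> edge_coef (move f) e u = edge_coef f e u.
  move=> /EV/andP[_ /subsetP eV]; rewrite /edge_coef; case: ifP => // ue.
  by apply: eq_bigr => w we; rewrite !moveV ?eV.
have movex (f : 'I_n -> R) : move f x = (f i + f j) / 2 by rewrite /move eqxx.
exists p => omega h1 h2; set E' := _ :|: _ in h1 h2 *.
have split_sum (f : 'I_n -> R) u : \sum_(e in E') omega e * edge_coef (move f) e u =
    omega [set x; i] * edge_coef (move f) [set x; i] u +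
    (omega [set x; j] * edge_coef (move f) [set x; j] u +
    (omega [set x; k] * edge_coef (move f) [set x; k] u +
     \sum_(e in E :\ [set i; j]) omega e * edge_coef f e u)).
  rewrite /E' -!setUA !big_setU1 // ?in_setU1 ?negb_or ?xE ?inj // 1?eq_sym //.
  by congr (_ + (_ + (_ + _))); apply: eq_bigr => e /setD1P[_ eE]; rewrite moveE.
have atx (f : 'I_n -> R) : \sum_(e in E :\ [set i; j]) omega e * edge_coef f e x = 0.
  rewrite big1 // => e /setD1P[_ /EV/andP[_ eV]]; rewrite /edge_coef ifN ?mulr0 //.
  by apply: contra xV; exact: subsetP eV x.
have eqx (f : 'I_n -> R) : \sum_(e in E') omega e * edge_coef (move f) e x = 0 ->
    (omega [set x; i] - omega [set x; j]) * ((f j - f i) / 2) +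
    omega [set x; k] * ((f i + f j) / 2 - f k) = 0.
  by rewrite split_sum atx addr0 !edge_coefl ?nx // movex !moveV // => <-; field.
pose a := (((q i).1 - (q j).1) / 2, ((q i).2 - (q j).2) / 2).
pose b := ((q k).1 - ((q i).1 + (q j).1) / 2, (q k).2 - ((q i).2 + (q j).2) / 2).
have area0 : area a b (0, 0) != 0.
  have -> : area a b (0, 0) = area (q i) (q j) (q k) * (- 2^-1) by rewrite /area /=; field.
  by rewrite mulf_neq0 ?oppr_eq0 ?invr_eq0 ?pnatr_eq0 // generic_area // eq_sym.
have [oij ok] : omega [set x; i] - omega [set x; j] = 0 /\ omega [set x; k] = 0.
  apply: (linear_eq2 area0); [rewrite -[RHS](eqx _ (h1 x))|rewrite -[RHS](eqx _ (h2 x))];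
    by rewrite /=; field.
have {}oij : omega [set x; j] = omega [set x; i] by apply/esym/eqP; rewrite -subr_eq0 oij.
(* The half edge from i to the midpoint is half of the vector from i to j, which gives the factor
   1/2. *)
pose omega' e := if e == [set i; j] then omega [set x; i] / 2 else omega e.
have sum' (f : 'I_n -> R) : (forall u, \sum_(e in E') omega e * edge_coef (move f) e u = 0) ->
    forall u, \sum_(e in E) omega' e * edge_coef f e u = 0.
  move=> h u; rewrite (big_setD1 _ ijE) /= /omega' eqxx.
  have -> : \sum_(e in E :\ [set i; j]) (if e == [set i; j] then omega [set x; i] / 2 else omega e)
      * edge_coef f e u = \sum_(e in E :\ [set i; j]) omega e * edge_coef f e u.
    by apply: eq_bigr => e /setD1P[/negPf->].
  case: (eqVneq u x) => [->|nux].
    by rewrite atx addr0 edge_coefE // !(negPf (nx _ _)) // mulr0.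
  have := h u; rewrite split_sum ok mul0r add0r oij !edge_coefE ?nx // movex !moveV // (negPf nux) => hu; apply: (etrans _ hu).
  case: (eqVneq u i) => [->|_]; first by rewrite (negPf nij); field.
  by case: ifP => _; [field|ring].
have om0 := sf omega' (sum' _ h1) (sum' _ h2).
have oi0 : omega [set x; i] = 0.
  have := om0 _ ijE; rewrite /omega' eqxx => /eqP.
  by rewrite mulf_eq0 invr_eq0 pnatr_eq0 orbF => /eqP.
move=> e; rewrite !inE => /orP[/orP[/orP[]|]/eqP->|/andP[nij' eE]] //; first by rewrite oij.
by have := om0 _ eE; rewrite /omega' (negPf nij').
Qed.
End HennebergStress.

(** * Local rigidity *)

Section Rigidity.
Variables (n : nat) (R : realType).
Local Open Scope ring_scope.
Implicit Types (e S V : {set 'I_n}) (E F G : {set {set 'I_n}}) (p q m v : 'I_n -> R * R).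

Definition motion_row v N (s : 'I_N -> 'I_n) : 'rV[R]_(N + N) :=
  row_mx (\row_j (v (s j)).1) (\row_j (v (s j)).2).

(* The three rows span the infinitesimal isometries: two translations and the
   rotation about the origin. *)
Definition trivial_motion m (i : 'I_3) (u : 'I_n) : R * R :=
  if i == 0 :> nat then (1, 0) else if i == 1 :> nat then (0, 1) else (- (m u).2, (m u).1).

(** Half the derivative at m of the squared length of ab along the velocity v. *)
Definition edge_flex m v a b :=
  ((m a).1 - (m b).1) * ((v a).1 - (v b).1) + ((m a).2 - (m b).2) * ((v a).2 - (v b).2).

Lemma motion_rowE m v F N (s : 'I_N -> 'I_n) i a b : injective s -> a != b ->
  enum_val i = [set a; b] -> (exists j, s j = a) -> (exists j, s j = b) ->
  (motion_row v s *m (rig F m s)^T) 0 i = edge_flex m v a b.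
Proof.
move=> injs nab eab ca cb; rewrite tr_row_mx mul_row_col mxE /edge_flex.
rewrite -(sum_edge_coef (fun u => (m u).1) (fun u => (v u).1) injs nab ca cb).
rewrite -(sum_edge_coef (fun u => (m u).2) (fun u => (v u).2) injs nab ca cb).
by rewrite !mxE; congr (_ + _); apply: eq_bigr => j _; rewrite !mxE mulrC eab.
Qed.

Lemma rig_motion m v F N (s : 'I_N -> 'I_n) : injective s -> simple_graph F ->
  (forall e u, e \in F -> u \in e -> exists j, s j = u) ->
  (forall a b, a != b -> [set a; b] \in F -> edge_flex m v a b = 0) ->
  motion_row v s *m (rig F m s)^T = 0.
Proof.
move=> injs simF cov flex; apply/rowP=> i.
have /eqP/cards2P[a [b [nab eab]]] := simF _ (enum_valP i).
have abF : [set a; b] \in F by rewrite -eab enum_valP.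
rewrite (motion_rowE _ _ injs nab eab) ?flex ?mxE //; apply: cov abF _; [exact: set21|exact: set22].
Qed.

(** The motions of S preserving the lengths of F to first order form a space of dimension 2|S| - |F|
    = 3, which contains the three trivial motions. These are independent because m takes two
    distinct values on S. *)
Lemma infinitesimally_rigid m v S F a b : simple_graph F -> (forall e, e \in F -> e \subset S) ->
  (#|F| + 3 = 2 * #|S|)%N -> stress_free F m -> a \in S -> b \in S -> m a != m b ->
  (forall a b, a != b -> [set a; b] \in F -> edge_flex m v a b = 0) ->
  exists t w, forall u, u \in S -> (v u).1 = t.1 - w * (m u).2 /\ (v u).2 = t.2 + w * (m u).1.
Proof.
move=> simF FS cF sf aS bS nmab flex; pose s : 'I_#|S| -> 'I_n := enum_val.
have injs : injective s by exact: enum_val_inj.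
have covS u : u \in S -> exists j, s j = u.
  by move=> uS; exists (enum_rank_in uS u); rewrite /s enum_rankK_in.
have cov e u : e \in F -> u \in e -> exists j, s j = u.
  by move=> /FS/subsetP eS /eS/covS.
have freeC := stress_free_row_free cov sf; set C := rig F m s in freeC.
pose T : 'M[R]_(3, #|S| + #|S|) := \matrix_(i < 3) motion_row (trivial_motion m i) s.
have dT (d : 'rV_3) j : (d *m T) 0 (lshift _ j) = d 0 0 - d 0 2%:R * (m (s j)).2 /\
                        (d *m T) 0 (rshift _ j) = d 0 1 + d 0 2%:R * (m (s j)).1.
  have l1 : lift ord0 ord0 = 1 :> 'I_3 by exact/val_inj.
  have l2 : lift ord0 (lift ord0 ord0) = 2%:R :> 'I_3 by exact/val_inj.
  split; rewrite mxE !big_ord_recl big_ord0 !mxE ?(unsplitK (inl j)) ?(unsplitK (inr j)) !mxE /=;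
    by rewrite l2 l1; ring.
have TC : (T <= kermx C^T)%MS.
  apply/sub_kermxP/row_matrixP=> i; rewrite row0 row_mul rowK.
  apply: rig_motion => // c d _ _; rewrite /edge_flex /trivial_motion.
  by do 2?case: ifP => _ /=; ring.
have freeT : row_free T.
  apply/row_free_ker0 => d dT0; have [ja eja] := covS _ aS; have [jb ejb] := covS _ bS.
  have [] := dT d ja; have [] := dT d jb; rewrite dT0 !mxE eja ejb => hb1 hb2 ha1 ha2.
  have d2 : d 0 2%:R = 0.
    apply/eqP; move: nmab; apply: contraNT => d2; rewrite -pair_eqE /=; apply/andP; split.
      by rewrite -(inj_eq (mulfI d2)); apply/eqP; lra.
    by rewrite -(inj_eq (mulfI d2)); apply/eqP; lra.
  rewrite d2 !mul0r in ha1 ha2; apply/rowP=> i; rewrite [RHS]mxE.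
  case: i => -[|[|[|//]]] lti.
  - by rewrite (_ : Ordinal lti = 0); [lra|exact/val_inj].
  - by rewrite (_ : Ordinal lti = 1); [lra|exact/val_inj].
  by rewrite (_ : Ordinal lti = 2%:R) ?d2 //; exact/val_inj.
have rk : \rank (kermx C^T) = \rank T.
  rewrite mxrank_ker mxrank_tr (eqnP freeC) (eqnP freeT); card_lia.
have := mxrank_leqif_sup TC; rewrite rk => -[_]; rewrite eqxx => /esym KT.
have : (motion_row v s <= T)%MS.
  by apply: submx_trans KT; apply/sub_kermxP; exact: rig_motion.
case/submxP=> d ed; exists (d 0 0, d 0 1), (d 0 2%:R) => u uS.
have [j <-] := covS _ uS; have [h1 h2] := dT d j.
by rewrite -h1 -h2 -ed /motion_row row_mxEl row_mxEr !mxE.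
Qed.

Definition midpoint p q u : R * R := (((p u).1 + (q u).1) / 2, ((p u).2 + (q u).2) / 2).

Lemma edge_flex_midpoint p q a b :
  edge_flex (midpoint p q) (fun u => ((q u).1 - (p u).1, (q u).2 - (p u).2)) a b =
  (sqdist (q a) (q b) - sqdist (p a) (p b)) / 2.
Proof. rewrite /edge_flex /sqdist /midpoint /=; by field. Qed.

(* With m = (p + q) / 2, equality of squared lengths is linear in q - p:
   |q_a - q_b|^2 - |p_a - p_b|^2 = 2 (m_a - m_b) . ((q - p)_a - (q - p)_b). *)
Lemma congruent_of_edges p q S F a b : simple_graph F -> (forall e, e \in F -> e \subset S) ->
  (#|F| + 3 = 2 * #|S|)%N -> stress_free F (midpoint p q) ->
  a \in S -> b \in S -> midpoint p q a != midpoint p q b ->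
  (forall c d, [set c; d] \in F -> sqdist (q c) (q d) = sqdist (p c) (p d)) ->
  exists t w, forall u, u \in S ->
    (q u).1 - (p u).1 = t.1 - w * (midpoint p q u).2 /\
    (q u).2 - (p u).2 = t.2 + w * (midpoint p q u).1.
Proof.
move=> simF FS cF sf aS bS nab len.
apply: (@infinitesimally_rigid (midpoint p q) (fun u => ((q u).1 - (p u).1, (q u).2 - (p u).2)) S F a b) => //.
by move=> c d _ cdF; rewrite edge_flex_midpoint len // subrr mul0r.
Qed.

(** The translation cancels in the difference of the displacements, and the rotation term is
    orthogonal to the difference of the midpoints. *)
Lemma congruent_sqdist p q (t : R * R) w c d :
  (q c).1 - (p c).1 = t.1 - w * (midpoint p q c).2 ->
  (q c).2 - (p c).2 = t.2 + w * (midpoint p q c).1 ->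
  (q d).1 - (p d).1 = t.1 - w * (midpoint p q d).2 ->
  (q d).2 - (p d).2 = t.2 + w * (midpoint p q d).1 ->
  sqdist (q c) (q d) = sqdist (p c) (p d).
Proof.
move=> c1 c2 d1 d2; have := edge_flex_midpoint p q c d; rewrite /edge_flex /= c1 c2 d1 d2.
move=> h; apply/eqP; rewrite -subr_eq0; apply/eqP.
by apply: (@mulIf _ (2^-1)); rewrite ?invr_eq0 ?pnatr_eq0 // -h mul0r /midpoint /=; field.
Qed.

(* The Cayley transform: q - p = t + w J (p + q) / 2 determines q as the image
   of p under a direct isometry. *)
Lemma congruent_isometry p q (t : R * R) w :
  (forall u, (q u).1 - (p u).1 = t.1 - w * (midpoint p q u).2 /\
             (q u).2 - (p u).2 = t.2 + w * (midpoint p q u).1) ->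
  exists2 f, euclid_isometry f & forall u, f (p u) = q u.
Proof.
(* With J the quarter turn, q solves (1 - kJ) q = (1 + kJ) p + t; the inverse of 1 - kJ is (1 + kJ)
   / D with D = 1 + k^2. *)
move=> h; pose k := w / 2; pose D := 1 + k ^+ 2.
have D0 : D != 0 by rewrite gt_eqF // /D ltr_pwDl // sqr_ge0.
pose f (z : R * R) : R * R :=
  (((z.1 - k * z.2 + t.1) - k * (z.2 + k * z.1 + t.2)) / D,
   ((z.2 + k * z.1 + t.2) + k * (z.1 - k * z.2 + t.1)) / D).
exists f => [c d|u]; first by rewrite /sqdist /f /=; rewrite /D in D0 *; field.
have [h1 h2] := h u; rewrite /midpoint /= in h1 h2.
rewrite [RHS]surjective_pairing; have eA : (p u).1 - k * (p u).2 + t.1 = (q u).1 + k * (q u).2 by rewrite /k; lra.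
have eB : (p u).2 + k * (p u).1 + t.2 = (q u).2 - k * (q u).1 by rewrite /k; lra.
by rewrite /f eA eB /D; congr (_, _) => /=; rewrite /D in D0; field.
Qed.

End Rigidity.

(** * Prescribing edge lengths *)

Section Perturbation.
Variable R : realType.
Local Open Scope ring_scope.

Definition norm1 m k (B : 'M[R]_(m, k)) := \sum_i \sum_j `|B i j|.

Lemma norm1_ge0 m k (B : 'M[R]_(m, k)) : 0 <= norm1 B.
Proof. by apply: sumr_ge0 => i _; apply: sumr_ge0. Qed.

Lemma norm1_coord m k (B : 'M[R]_(m, k)) i j : `|B i j| <= norm1 B.
Proof.
rewrite /norm1 (bigD1 i) //= (bigD1 j) //= -addrA lerDl addr_ge0 ?sumr_ge0 // => i' _.
exact: sumr_ge0.
Qed.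

Lemma norm1_eq0 m k (B : 'M[R]_(m, k)) : norm1 B <= 0 -> B = 0.
Proof.
move=> B0; apply/matrixP=> i j; apply/eqP; rewrite mxE -normr_le0.
exact: le_trans (norm1_coord B i j) B0.
Qed.

Lemma norm1D m k (B C : 'M[R]_(m, k)) : norm1 (B + C) <= norm1 B + norm1 C.
Proof.
rewrite -big_split; apply: ler_sum => i _; rewrite -big_split.
by apply: ler_sum => j _; rewrite mxE ler_normD.
Qed.

Lemma norm1N m k (B : 'M[R]_(m, k)) : norm1 (- B) = norm1 B.
Proof. by apply: eq_bigr => i _; apply: eq_bigr => j _; rewrite mxE normrN. Qed.

Lemma norm1M m k l (B : 'M[R]_(m, k)) (C : 'M[R]_(k, l)) : norm1 (B *m C) <= norm1 B * norm1 C.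
Proof.
rewrite /norm1 mulr_suml; apply: ler_sum => i _.
apply: (@le_trans _ _ (\sum_j \sum_k0 `|B i k0| * `|C k0 j|)).
  apply: ler_sum => j _; rewrite mxE; apply: le_trans (ler_norm_sum _ _ _) _.
  by apply: ler_sum => k0 _; rewrite normrM.
rewrite exchange_big mulr_suml; apply: ler_sum => k0 _ /=; rewrite -mulr_sumr.
apply: ler_wpM2l => //; rewrite [leRHS](bigD1 k0) //= lerDl.
by apply: sumr_ge0 => i' _; apply: sumr_ge0.
Qed.

Lemma norm1_le m k (B : 'M[R]_(m, k)) d : (forall i j, `|B i j| <= d) -> norm1 B <= (m * k)%:R * d.
Proof.
move=> Bd; apply: (@le_trans _ _ (\sum_(i < m) \sum_(j < k) d)).
  by apply: ler_sum => i _; apply: ler_sum.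
by rewrite !sumr_const !card_ord -mulrnA mulr_natl mulnC.
Qed.

(** Let P be a right inverse of A. If yB = 0 then y = y(A - B)P, and for B close to A this shrinks
    the norm of y by the factor K / (K + 1) at least, so y = 0. *)
Lemma row_free_near m k (A : 'M[R]_(m, k)) : row_free A ->
  exists2 d : R, 0 < d & forall B : 'M[R]_(m, k), (forall i j, `|B i j - A i j| <= d) -> row_free B.
Proof.
move=> /row_freeP[P AP]; pose K := (m * k)%:R * norm1 P.
have K0 : 0 <= K by rewrite mulr_ge0 ?norm1_ge0.
have K1 : 0 < K + 1 by rewrite ltr_pwDr.
exists (K + 1)^-1; first by rewrite invr_gt0.
move=> B AB; apply/row_free_ker0 => y yB; apply: norm1_eq0.
have ey : y = y *m (A - B) *m P by rewrite mulmxBr yB subr0 -mulmxA AP mulmx1.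
have : norm1 y <= norm1 y * (K / (K + 1)).
  rewrite {1}ey; apply: le_trans (norm1M _ _) _.
  apply: le_trans (ler_wpM2r (norm1_ge0 _) (norm1M _ _)) _; rewrite -mulrA.
  apply: ler_wpM2l; first exact: norm1_ge0.
  rewrite /K mulrAC; apply: ler_wpM2r; first exact: norm1_ge0.
  by apply: norm1_le => i j; rewrite !mxE distrC.
have -> : K / (K + 1) = 1 - (K + 1)^-1 by field; rewrite gt_eqF.
rewrite mulrBr mulr1 => h; rewrite leNgt; apply/negP=> y0.
have : 0 < norm1 y * (K + 1)^-1 by rewrite mulr_gt0 ?invr_gt0.
by lra.
Qed.

Lemma le0_geometric (x c : R) : (forall k, x <= c / 2 ^+ k) -> x <= 0.
Proof.
move=> h; rewrite leNgt; apply/negP=> x0.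
have c0 : 0 < c by have := h 0%N; rewrite expr0 divr1; exact: lt_le_trans.
have := archi_boundP (divr_ge0 (ltW c0) (ltW x0)); set k := Num.bound _ => hk.
have := h k; rewrite leNgt ltr_pdivrMr ?exprn_gt0 // mulrC -ltr_pdivrMr //.
by rewrite (lt_trans hk) // -natrX ltr_nat ltn_expl.
Qed.

(** Banach's fixed point theorem on a ball, iterating from 0; the limit is built coordinate by
    coordinate from nested intervals. *)
Lemma contraction_fixpoint k (T : 'rV[R]_k -> 'rV[R]_k) r : 0 <= r ->
  (forall z, norm1 z <= r -> norm1 (T z) <= r) ->
  (forall z z', norm1 z <= r -> norm1 z' <= r -> norm1 (T z - T z') <= norm1 (z - z') / 2) ->
  exists2 z, norm1 z <= r & T z = z.
Proof.
move=> r0 ballT contr; pose x i := iter i T 0.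
have ball i : norm1 (x i) <= r.
  elim: i => [|i IH]; last exact: ballT.
  by rewrite /= /norm1 big1 // => i _; rewrite big1 // => j _; rewrite mxE normr0.
have half i : r / 2 ^+ i.+1 = r / 2 ^+ i / 2 by rewrite exprSr invfM mulrA.
have step i : norm1 (x i.+1 - x i) <= r / 2 ^+ i.
  elim: i => [|i IH]; first by rewrite /= subr0 expr0 divr1 ballT // (ball 0%N).
  apply: le_trans (contr (x i.+1) (x i) (ball _) (ball _)) _.
  by rewrite half; lra.
(* The radius 2r / 2^i decreases by r / 2^i at each step, exactly the bound on the step of the
   iteration, so the intervals are nested. *)
have coord j : exists L, forall i, x i 0 j - 2 * (r / 2 ^+ i) <= L <= x i 0 j + 2 * (r / 2 ^+ i).
  have sj i : `|x i.+1 0 j - x i 0 j| <= r / 2 ^+ i.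
    by apply: le_trans (step i); have := norm1_coord (x i.+1 - x i) 0 j; rewrite !mxE.
  apply: nested_intervals => i.
  - by have := sj i; rewrite half ler_norml => /andP[? ?]; lra.
  - by have := sj i; rewrite half ler_norml => /andP[? ?]; lra.
  have : 0 <= r / 2 ^+ i by rewrite divr_ge0 ?exprn_ge0.
  by lra.
have [L hL] := boolp.choice coord.
pose z : 'rV[R]_k := \row_j L j; pose c := (1 * k)%:R * (2 * r).
have near i : norm1 (z - x i) <= c / 2 ^+ i.
  rewrite /c -!mulrA; apply: norm1_le => i0 j; rewrite !mxE ord1.
  by have := hL j i; rewrite ler_norml => /andP[? ?]; apply/andP; split; lra.
have zr : norm1 z <= r.
  rewrite -subr_le0; apply: (le0_geometric (c := c)) => i.
  have := norm1D (z - x i) (x i); rewrite subrK; have := near i; have := ball i; lra.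
exists z => //; apply/eqP; rewrite -subr_eq0; apply/eqP/norm1_eq0/(le0_geometric (c := 2 * c)) => i.
have -> : T z - z = (T z - T (x i)) - (z - x i.+1) by rewrite opprB addrA subrK.
apply: le_trans (norm1D _ _) _; rewrite norm1N.
have := contr _ _ zr (ball i); have := near i; have := near i.+1.
have -> : c / 2 ^+ i.+1 = c / 2 ^+ i / 2 by rewrite exprSr invfM mulrA.
have : 0 <= c / 2 ^+ i by apply: le_trans (near i); exact: norm1_ge0.
by rewrite -mulrA; lra.
Qed.

Variable n : nat.
Implicit Types (F : {set {set 'I_n}}) (p q : 'I_n -> R * R).

Definition close p q (d : R) := forall u, `|(q u).1 - (p u).1| <= d /\ `|(q u).2 - (p u).2| <= d.

Lemma stress_free_near F p : stress_free F p ->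
  exists2 d, 0 < d & forall q, close p q d -> stress_free F q.
Proof.
move=> sf; have cov e u : e \in F -> u \in e -> exists j : 'I_n, id j = u by exists u.
have [d d0 hd] := row_free_near (stress_free_row_free cov sf).
have n0 : 0 < n.*2%:R + 1 :> R by rewrite ltr_pwDr.
(* A coefficient is a sum of at most n differences, each changing by at most twice this amount. *)
exists (d / (n.*2%:R + 1)) => [|q pq]; first by rewrite divr_gt0.
apply: row_free_stress_free; apply: hd.
have coefB (f g : 'I_n -> R) e u : (forall u, `|g u - f u| <= d / (n.*2%:R + 1)) ->
    `|edge_coef g e u - edge_coef f e u| <= d.
  move=> fg; rewrite /edge_coef; case: ifP => _; last by rewrite subrr normr0 ltW.
  rewrite -sumrB; apply: le_trans (ler_norm_sum _ _ _) _.
  apply: (@le_trans _ _ (\sum_(w in e) (2 * (d / (n.*2%:R + 1))))).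
    apply: ler_sum => w _; have := fg u; have := fg w; rewrite !ler_norml.
    by move=> /andP[? ?] /andP[? ?]; apply/andP; split; lra.
  rewrite sumr_const -[_ *+ #|_|]mulr_natl mulrA mulrA ler_pdivrMr // mulrC ler_wpM2l ?ltW //.
  rewrite -natrM natr1 ltr_nat ltnS -muln2 leq_mul2r /=.
  by have := max_card (mem e); rewrite card_ord.
move=> i j; case: (split_ordP j) => j' ->; rewrite /rig /rigidity_mx ?row_mxEl ?row_mxEr !mxE;
  by apply: coefB => u; case: (pq u).
Qed.

(** Displacing p by zG changes the squared lengths by z plus a quadratic remainder N z, since G
    comes from a right inverse of the rigidity matrix. Prescribing the change y means z = y - N z,
    solved as a fixed point on a small ball. *)
Lemma realize_lengths F p eps : simple_graph F -> stress_free F p -> 0 < eps ->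
  exists2 eta, 0 < eta & forall y : {set 'I_n} -> R, (forall e, `|y e| <= eta) ->
  exists2 q, close p q eps & forall a b, [set a; b] \in F ->
    sqdist (q a) (q b) = sqdist (p a) (p b) + y [set a; b].
Proof.
move=> simF sf eps0; have cov e u : e \in F -> u \in e -> exists j : 'I_n, id j = u by exists u.
have /row_freeP[P CP] := stress_free_row_free cov sf; set C := rig _ _ _ in CP.
(* The factor 1/2 cancels the 2 of the linear term in the squared length. *)
pose G := 2^-1 *: P^T; pose k := #|F|.
have ends (i : 'I_k) : exists ab : 'I_n * 'I_n, ab.1 != ab.2 /\ enum_val i = [set ab.1; ab.2].
  have /eqP/cards2P[a [b [nab eab]]] := simF _ (enum_valP i).
  by exists (a, b).
have [ab hab] := boolp.choice ends.
pose disp (z : 'rV[R]_k) u : R * R := ((z *m G) 0 (lshift n u), (z *m G) 0 (rshift n u)).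
pose N z i := sqdist (disp z (ab i).1) (disp z (ab i).2).
pose M := 2 * norm1 G.
have M0 : 0 <= M by rewrite mulr_ge0 ?norm1_ge0.
have dispB z z' u : `|(disp z u).1 - (disp z' u).1| <= norm1 (z - z') * norm1 G /\
                    `|(disp z u).2 - (disp z' u).2| <= norm1 (z - z') * norm1 G.
  have h j : `|(z *m G) 0 j - (z' *m G) 0 j| <= norm1 (z - z') * norm1 G.
    apply: le_trans (norm1M _ _); have := norm1_coord ((z - z') *m G) 0 j.
    by rewrite mulmxBl !mxE.
  by split; exact: h.
have sqB (x x' s t : R) : `|x - x'| <= s -> `|x + x'| <= t -> `|x ^+ 2 - x' ^+ 2| <= s * t.
  by move=> h1 h2; rewrite subr_sqr normrM; apply: ler_pM.
have dispr z r u : norm1 z <= r -> `|(disp z u).1| <= r * norm1 G /\ `|(disp z u).2| <= r * norm1 G.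
  move=> zr; have h j : `|(z *m G) 0 j| <= r * norm1 G.
    by apply: le_trans (norm1_coord _ _ _) (le_trans (norm1M _ _) (ler_wpM2r (norm1_ge0 _) zr)).
  by split; exact: h.
have NB r z z' i : norm1 z <= r -> norm1 z' <= r ->
    `|N z i - N z' i| <= norm1 (z - z') * (4 * M ^+ 2 * r).
  move=> zr zr'; have nz := norm1_ge0 (z - z').
  have diff (x y x' y' : R) : `|x - x'| <= norm1 (z - z') * norm1 G ->
      `|y - y'| <= norm1 (z - z') * norm1 G -> `|(x - y) - (x' - y')| <= norm1 (z - z') * M.
    by rewrite /M !ler_norml => /andP[? ?] /andP[? ?]; apply/andP; split; lra.
  have add (x y x' y' : R) : `|x| <= r * norm1 G -> `|y| <= r * norm1 G ->
      `|x'| <= r * norm1 G -> `|y'| <= r * norm1 G -> `|(x - y) + (x' - y')| <= 2 * r * M.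
    rewrite /M !ler_norml => /andP[? ?] /andP[? ?] /andP[? ?] /andP[? ?].
    by apply/andP; split; lra.
  have [a1 a2] := dispB z z' (ab i).1; have [b1 b2] := dispB z z' (ab i).2.
  have [c1 c2] := dispr z r (ab i).1 zr; have [d1 d2] := dispr z r (ab i).2 zr.
  have [e1 e2] := dispr z' r (ab i).1 zr'; have [f1 f2] := dispr z' r (ab i).2 zr'.
  have h1 := sqB _ _ _ _ (diff _ _ _ _ a1 b1) (add _ _ _ _ c1 d1 e1 f1).
  have h2 := sqB _ _ _ _ (diff _ _ _ _ a2 b2) (add _ _ _ _ c2 d2 e2 f2).
  rewrite /N /sqdist opprD addrACA; apply: le_trans (ler_normD _ _) _.
  by apply: le_trans (lerD h1 h2) _; rewrite le_eqVlt; apply/orP; left; apply/eqP; ring.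
(* On the ball of radius r each coordinate of N has Lipschitz constant 4 M^2 r, so r <= 1/K makes
   the k coordinates together contract by 1/2. *)
pose K := 8 * k%:R * M ^+ 2 + 1.
have K0 : 0 < K by rewrite ltr_pwDr // mulr_ge0 ?sqr_ge0 // mulr_ge0 ?ler0n.
have G0 : 0 < norm1 G + 1 by rewrite ltr_pwDr ?norm1_ge0.
pose r := Num.min (eps / (norm1 G + 1)) K^-1.
have r0 : 0 < r by rewrite lt_min divr_gt0 //= invr_gt0.
have reps : r * norm1 G <= eps.
  have : r * (norm1 G + 1) <= eps by rewrite -ler_pdivlMr // ge_min lexx.
  by rewrite mulrDr mulr1; lra.
have rK : 8 * k%:R * M ^+ 2 * r <= 1.
  have : r * K <= 1 by rewrite -ler_pdivlMr // mul1r ge_min lexx orbT.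
  by rewrite /K; lra.
have k0 : 0 < 2 * (k%:R + 1) :> R by rewrite mulr_gt0 // ltr_pwDr.
exists (r / (2 * (k%:R + 1))) => [|y hy]; first by rewrite divr_gt0.
pose T (z : 'rV[R]_k) : 'rV[R]_k := \row_i (y (enum_val i) - N z i).
have contr z z' : norm1 z <= r -> norm1 z' <= r -> norm1 (T z - T z') <= norm1 (z - z') / 2.
  move=> zr zr'; have nz := norm1_ge0 (z - z').
  apply: (@le_trans _ _ ((1 * k)%:R * (norm1 (z - z') * (4 * M ^+ 2 * r)))).
    apply: norm1_le => i j; rewrite !mxE.
    have -> : y (enum_val j) - N z j - (y (enum_val j) - N z' j) = - (N z j - N z' j) by ring.
    by rewrite normrN NB.
  by rewrite mul1n; have := ler_wpM2l nz rK; lra.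
have T0 : norm1 (T 0) <= r / 2.
  apply: (@le_trans _ _ ((1 * k)%:R * (r / (2 * (k%:R + 1))))).
    apply: norm1_le => i j; rewrite !mxE /N /disp !mul0mx /sqdist /= !mxE subrr expr0n /= addr0 subr0.
    exact: hy.
  rewrite mul1n mulrCA ler_pM2l // ler_pdivrMr // mulrC.
  by lra.
have normT0 : norm1 (0 : 'rV[R]_k) <= r.
  by rewrite /norm1 big1 ?ltW // => i _; rewrite big1 // => j _; rewrite mxE normr0.
have ballT z : norm1 z <= r -> norm1 (T z) <= r.
  move=> zr; have := norm1D (T z - T 0) (T 0); rewrite subrK.
  by have := contr z 0 zr normT0; rewrite subr0; lra.
have [z zr Tz] := contraction_fixpoint (ltW r0) ballT contr.
exists (fun u => ((p u).1 + (disp z u).1, (p u).2 + (disp z u).2)) => [u|a b abF] /=.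
  have [h1 h2] := dispr z r u zr; rewrite !(addrC (p u).1) !(addrC (p u).2) !addrK.
  by split; [apply: le_trans h1 reps|apply: le_trans h2 reps].
have nab : a != b by apply/eqP=> eab; have := simF _ abF; rewrite eab setUid cards1.
pose i := enum_rank_in abF [set a; b].
have ei : enum_val i = [set a; b] by rewrite enum_rankK_in.
have flex : 2 * (edge_flex p (disp z) a b) = z 0 i.
  rewrite -(@motion_rowE _ _ p (disp z) F n id i) //; [|by exists a|by exists b].
  have -> : motion_row (disp z) id = z *m G.
    by rewrite -[RHS]hsubmxK; congr row_mx; apply/rowP=> j; rewrite [LHS]mxE [RHS]mxE.
  rewrite -mulmxA /G -scalemxAl -scalemxAr -trmx_mul -/C CP trmx1 mulmx1 mxE.
  by rewrite mulrA divff ?mul1r // pnatr_eq0.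
have Ni : N z i = sqdist (disp z a) (disp z b).
  have [nc] := hab i; rewrite ei /N; move: (ab i).1 (ab i).2 nc => c d ncd ecd.
  have : c \in [set a; b] by rewrite ecd set21.
  rewrite !inE => /orP[]/eqP ec; rewrite ec in ncd ecd *.
    by rewrite (set2_inj _ ecd) // eq_sym.
  by rewrite setUC in ecd; rewrite (set2_inj _ ecd) // /sqdist; ring.
have /rowP/(_ i) := Tz; rewrite mxE Ni ei => zi.
have -> : y [set a; b] = z 0 i + sqdist (disp z a) (disp z b) by rewrite -zi subrK.
by rewrite -flex /edge_flex /sqdist /=; ring.
Qed.

End Perturbation.

(** * The equivalence *)

Section GenericRigidity.
Variables (n : nat) (R : realType).
Hypothesis n2 : (2 <= n)%N.
Local Open Scope ring_scope.
Implicit Types (e S V : {set 'I_n}) (B E F G : {set {set 'I_n}}) (p q m : 'I_n -> R * R).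

(** The inverse of 1 plus the sum of the inverse radii is positive and below each of the finitely
    many radii. *)
Lemma uniform_radius (T : finType) (P : T -> R -> Prop) :
  (forall x, exists2 d, 0 < d & forall d', 0 < d' <= d -> P x d') ->
  exists2 d, 0 < d & forall x d', 0 < d' <= d -> P x d'.
Proof.
move=> hP; have h x : exists d, 0 < d /\ forall d', 0 < d' <= d -> P x d'.
  by have [d] := hP x; exists d.
have [d hd] := boolp.choice h; pose s := \sum_x (d x)^-1.
have s0 : 0 <= s by apply: sumr_ge0 => x _; rewrite invr_ge0 ltW //; case: (hd x).
have s1 : 0 < s + 1 by rewrite ltr_pwDr.
exists (s + 1)^-1 => [|x d' /andP[d'0 d's]]; first by rewrite invr_gt0.
have [dx0 hx] := hd x; apply: hx; rewrite d'0 (le_trans d's) // invf_ple ?posrE //.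
rewrite /s (bigD1 x) //= -addrA lerDl addr_ge0 // sumr_ge0 // => z _.
by rewrite invr_ge0 ltW //; case: (hd z).
Qed.

Lemma sparse_stress_free B p : simple_graph B -> sparse B -> generic_config p -> stress_free B p.
Proof.
move=> simB spB gen; have [|L sBL [simL spL cL]] := sparse_extend _ simB spB.
  by rewrite card_ord.
have hL : henneberg setT L.
  by apply: sparse_henneberg; rewrite ?cardsT -?cL // card_ord.
have [p0 sf0] := henneberg_stress_free R hL.
exact: stress_free_sub sBL (generic_stress_free sf0 gen).
Qed.

(** If the ends coincided, the unit stress on that edge alone would be in equilibrium. *)
Lemma stress_free_edge F m a b : stress_free F m -> a != b -> [set a; b] \in F -> m a != m b.
Proof.
move=> sf nab abF; apply/eqP=> mab.
have sum0 (f : 'I_n -> R) u : f a = f b ->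
    \sum_(e in F) (e == [set a; b])%:R * edge_coef f e u = 0.
  move=> fab; rewrite big1 // => e _; case: eqP => [->|_]; last by rewrite mul0r.
  by rewrite edge_coefE // fab subrr !if_same mulr0.
have := sf (fun e => (e == [set a; b])%:R) _ _ _ abF; rewrite eqxx => h.
have /eqP := h (fun u => sum0 _ u (congr1 fst mab)) (fun u => sum0 _ u (congr1 snd mab)).
by rewrite oner_eq0.
Qed.

(** The midpoint configuration is as close to p as q is, so independence of the edges induced on S
    persists there and the linearised length equations apply. *)
Lemma tight_congruent B S p : simple_graph B -> sparse B -> tight B S -> generic_config p ->
  exists2 d, 0 < d & forall q, close p q d ->
    (forall c d, [set c; d] \in B -> sqdist (q c) (q d) = sqdist (p c) (p d)) ->
    exists t w, forall u, u \in S ->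
      (q u).1 - (p u).1 = t.1 - w * (midpoint p q u).2 /\
      (q u).2 - (p u).2 = t.2 + w * (midpoint p q u).1.
Proof.
move=> simB spB [S2 tS] gen.
have sFB : induced B S \subset B by apply/subsetP=> e; rewrite inE => /andP[].
have simF : simple_graph (induced B S) by move=> e /(subsetP sFB)/simB.
have FS e : e \in induced B S -> e \subset S by rewrite inE => /andP[].
have [d d0 near] := stress_free_near (stress_free_sub sFB (sparse_stress_free simB spB gen)).
exists d => // q pq len; have sf : stress_free (induced B S) (midpoint p q).
  apply: near => u; have [] := pq u; rewrite /midpoint /= !ler_norml.
  by move=> /andP[? ?] /andP[? ?]; split; apply/andP; split; lra.
have /card_gt0P[e eF] : (0 < #|induced B S|)%N by card_lia.
have /eqP/cards2P[a [b [nab eab]]] := simF _ eF; have := FS _ eF; rewrite eab in eF *.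
rewrite subUset !sub1set => /andP[aS bS].
apply: congruent_of_edges simF FS tS sf aS bS (stress_free_edge sf nab eF) _.
by move=> c c' /(subsetP sFB); exact: len.
Qed.

Lemma sparse_generically_rigid B : simple_graph B -> sparse B -> (#|B| + 3 = 2 * n)%N ->
  generically_rigid R B.
Proof.
move=> simB spB cB p gen; split; first exact: generic_inj.
have tT : tight B setT.
  by split; rewrite ?induced_setT cardsT card_ord.
have [d d0 hd] := tight_congruent simB spB tT gen.
exists (d ^+ 2) => [|q injq pq len]; first by rewrite exprn_gt0.
have close_pq : close p q d.
  move=> u; have : sqdist (p u) (q u) <= d ^+ 2.
    apply: le_trans pq; rewrite (bigD1 u) //= lerDl sumr_ge0 // => w _.
    by rewrite addr_ge0 ?sqr_ge0.
  rewrite /sqdist => h; split; rewrite distrC -ler_sqr ?nnegrE ?normr_ge0 ?(ltW d0) // real_normK ?num_real //.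
    by apply: le_trans h; rewrite lerDl sqr_ge0.
  by apply: le_trans h; rewrite lerDr sqr_ge0.
have [t [w hw]] := hd q close_pq len.
have [f isof fp] := congruent_isometry (fun u => hw u (in_setT u)).
by exists f; split=> // z; split=> -[u <-]; exists u; rewrite fp.
Qed.

Lemma generically_rigid_sub E F : E \subset F -> generically_rigid R E -> generically_rigid R F.
Proof.
move=> /subsetP sEF rigE p gen; have [injp [eps eps0 h]] := rigE p gen.
split=> //; exists eps => // q injq pq len; apply: h => // u v uvE.
exact/len/sEF.
Qed.

(** Independence of B + uv allows the length of uv to change while those of B stay fixed. The other
    edges of E lie in tight sets, which move congruently, so all lengths of E are kept. *)
Lemma flexible B E u v p : simple_graph B -> B \subset E -> u != v -> [set u; v] \notin B ->
  sparse ([set u; v] |: B) ->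
  (forall e, e \in E -> e \in B \/ exists2 S, tight B S & e \subset S) ->
  generic_config p -> ~ framework_rigid E p.
Proof.
move=> simB sBE nuv uvB spL EB gen [injp [eps eps0 rigid]].
set L := _ |: B in spL.
have spB : sparse B by apply: sub_sparse spL; exact: subsetUr.
have simL : simple_graph L.
  by move=> e; rewrite in_setU1 => /orP[/eqP->|/simB//]; rewrite cards2 nuv.
have [|dt dt0 hdt] := @uniform_radius {set 'I_n} (fun S d => tight B S -> forall q, close p q d ->
    (forall a b, [set a; b] \in B -> sqdist (q a) (q b) = sqdist (p a) (p b)) ->
    forall a b, a \in S -> b \in S -> sqdist (q a) (q b) = sqdist (p a) (p b)).
  move=> S; case: (boolp.EM (tight B S)) => [tS|ntS]; last by exists 1.
  have [d d0 hd] := tight_congruent simB spB tS gen; exists d => // d' /andP[_ d'd] _ q pq len a b aS bS.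
  have [|t [w hw]] := hd q _ len.
    by move=> c; have [h1 h2] := pq c; split; [apply: le_trans h1 d'd|apply: le_trans h2 d'd].
  have [a1 a2] := hw _ aS; have [b1 b2] := hw _ bS.
  exact: congruent_sqdist a1 a2 b1 b2.
have apart (x y x' y' d : R) : x != y -> `|x' - x| <= d -> `|y' - y| <= d -> d <= `|x - y| / 4 -> x' != y'.
  move=> nxy hx hy hd; apply/eqP=> exy; rewrite -exy in hy.
  have : 0 < `|x - y| by rewrite normr_gt0 subr_eq0.
  have : `|x - y| <= `|x' - y| + `|x' - x| by rewrite [leRHS]addrC (distrC x' x); exact: ler_distD.
  by lra.
have [|dj dj0 hdj] := @uniform_radius ('I_n * 'I_n)%type
    (fun ab d => ab.1 != ab.2 -> forall q, close p q d -> q ab.1 != q ab.2).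
  move=> [a b] /=; case: (eqVneq a b) => [_|nab]; first by exists 1.
  have : p a != p b by rewrite (inj_eq injp).
  case: (eqVneq (p a).1 (p b).1) => [e1 np|n1 _].
    have n2' : (p a).2 != (p b).2.
      by apply: contraNneq np => e2; rewrite (surjective_pairing (p a)) e1 e2 -surjective_pairing.
    exists (`|(p a).2 - (p b).2| / 4) => [|d /andP[_ hd] _ q pq].
      by rewrite divr_gt0 // normr_gt0 subr_eq0.
    have := apart _ _ _ _ _ n2' (pq a).2 (pq b).2 hd.
    by apply: contraNneq => ->.
  exists (`|(p a).1 - (p b).1| / 4) => [|d /andP[_ hd] _ q pq].
    by rewrite divr_gt0 // normr_gt0 subr_eq0.
  have := apart _ _ _ _ _ n1 (pq a).1 (pq b).1 hd.
  by apply: contraNneq => ->.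
(* Rigidity compares only the images of p and q, possibly with vertices permuted. So the new squared
   length of uv has to differ from the squared distances of all pairs of points of p. *)
have [|da da0 hda] := @uniform_radius ('I_n * 'I_n)%type
    (fun ab d => sqdist (p u) (p v) + d != sqdist (p ab.1) (p ab.2)).
  move=> [a b] /=; case: (lerP (sqdist (p a) (p b)) (sqdist (p u) (p v))) => h.
    by exists 1 => // d /andP[d0 _]; apply/eqP; lra.
  exists ((sqdist (p a) (p b) - sqdist (p u) (p v)) / 2); first by lra.
  by move=> d /andP[d0 hd]; apply/eqP; lra.
have n0 : 0 < (2 * n)%:R :> R by rewrite ltr0n; lia.
(* The bounds by [dt] and [dj] keep tight sets congruent and q injective. As r <= 1, squares of
   displacements are at most r, and 2nr <= eps bounds their sum. *)
pose r := Num.min (Num.min dt dj) (Num.min 1 (eps / (2 * n)%:R)).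
have r0 : 0 < r by rewrite !lt_min dt0 dj0 ltr01 divr_gt0.
have rdt : r <= dt by rewrite !ge_min lexx.
have rdj : r <= dj by rewrite !ge_min lexx !orbT.
have r1 : r <= 1 by rewrite !ge_min lexx !orbT.
have reps : (2 * n)%:R * r <= eps by rewrite mulrC -ler_pdivlMr // !ge_min lexx !orbT.
have [eta eta0 heta] := realize_lengths simL (sparse_stress_free simL spL gen) r0.
pose t := Num.min da eta.
have t0 : 0 < t by rewrite lt_min da0.
have [|q pq lenL] := heta (fun e => if e == [set u; v] then t else 0).
  by move=> e; case: ifP => _; [rewrite gtr0_norm // ge_min lexx orbT|rewrite normr0 ltW].
have lenB a b : [set a; b] \in B -> sqdist (q a) (q b) = sqdist (p a) (p b).
  move=> abB; rewrite lenL ?in_setU1 ?abB ?orbT // ifN ?addr0 //.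
  by apply: contraNneq uvB => <-.
have lenE a b : [set a; b] \in E -> sqdist (q a) (q b) = sqdist (p a) (p b).
  move=> /EB[/lenB//|[S tS]]; rewrite subUset !sub1set => /andP[aS bS].
  by apply: (hdt S r) => //; rewrite r0.
have injq : injective q.
  move=> a b eab; apply/eqP; apply: contraT => nab.
  by have := hdj (a, b) r; rewrite r0 rdj => /(_ isT nab q pq); rewrite /= eab eqxx.
have sumq : \sum_(w < n) sqdist (p w) (q w) <= eps.
  apply: le_trans reps; rewrite natrM mulrAC mulr_natr -[n in _ *+ n]card_ord -sumr_const.
  apply: ler_sum => w _; have [h1 h2] := pq w.
  have sq (x : R) : `|x| <= r -> x ^+ 2 <= r.
    move=> xr; rewrite -real_normK ?num_real //; apply: le_trans (_ : `|x| <= _) => //.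
    by rewrite expr2 ler_piMl // (le_trans xr).
  rewrite /sqdist; have := sq _ h1; have := sq _ h2.
  by rewrite -[_ - (p w).2]opprB -[_ - (p w).1]opprB !sqrrN; lra.
have [f [isof imf]] := rigid q injq sumq lenE.
have [a ea] := (imf (q u)).1 (ex_intro _ u erefl).
have [b eb] := (imf (q v)).1 (ex_intro _ v erefl).
have := lenL u v; rewrite setU11 eqxx -ea -eb isof => /(_ isT) /esym/eqP.
by apply/negP; apply: (hda (a, b) t); rewrite t0 ge_min lexx.
Qed.

Lemma laman_sparse E : laman E -> sparse E /\ (#|E| + 3 = 2 * n)%N.
Proof.
move=> [cE spE]; split=> [S S2|]; last by lia.
have sFE : induced E S \subset E by apply/subsetP=> e; rewrite inE => /andP[].
have := spE S (induced E S) S2 sFE; move=> /(_ _)-h.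
have {h} : (#|induced E S| <= 2 * #|S| - 3)%N by apply: h => e; rewrite inE => /andP[].
by card_lia.
Qed.

Lemma sparse_laman E : sparse E -> (#|E| + 3 = 2 * n)%N -> laman E.
Proof.
move=> spE cE; split=> [|S F S2 sFE FS]; first by lia.
have : F \subset induced E S.
  by apply/subsetP=> e eF; rewrite inE (subsetP sFE) ?FS.
by move/subset_leq_card; have := spE S S2; card_lia.
Qed.

(** For minimality, [flexible] is applied with the deleted edge as uv: putting it back restores the
    sparse graph E. *)
Lemma laman_minimally_rigid E : simple_graph E -> laman E -> generically_minimally_rigid R E.
Proof.
move=> simE /laman_sparse[spE cE]; split; first exact: sparse_generically_rigid.
move=> e eE rigid; have [p gen] := exists_generic_config R n.
have /eqP/cards2P[a [b [nab eab]]] := simE _ eE.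
apply: (@flexible (E :\ e) (E :\ e) a b p) (rigid p gen) => //.
- by move=> f /setD1P[_ /simE].
- by rewrite -eab setD11.
- by rewrite -eab setD1K.
by left.
Qed.

Lemma minimally_rigid_laman E : simple_graph E -> generically_minimally_rigid R E -> laman E.
Proof.
move=> simE [rigE minE].
pose sparseb B := [forall S : {set 'I_n}, (2 <= #|S|) ==> (#|induced B S| + 3 <= 2 * #|S|)]%N.
have sparseP B : reflect (sparse B) (sparseb B).
  apply: (iffP forallP) => [h S S2|h S]; first by have /implyP := h S; apply.
  by apply/implyP; exact: h.
pose P (B : {set {set 'I_n}}) := sparseb B && (B \subset E).
have sp0 : P set0.
  rewrite /P sub0set andbT; apply/sparseP=> S S2.
  rewrite (_ : induced set0 S = set0) ?cards0; first by lia.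
  by apply/setP=> e; rewrite !inE.
case: (arg_maxnP (fun B : {set {set 'I_n}} => #|B|) sp0) => B /andP[/sparseP spB sBE] maxB.
have simB : simple_graph B by move=> e /(subsetP sBE)/simE.
(* By maximality of B, an edge of E outside B cannot be added sparsely, so it lies in a tight
   set. *)
have EB e : e \in E -> e \in B \/ exists2 S, tight B S & e \subset S.
  move=> eE; case: (boolP (e \in B)) => [|neB]; [by left|right].
  apply: boolp.contrapT => nt; have /eqP/cards2P[a [b [nab eab]]] := simE _ eE.
  have spe : sparse (e |: B).
    rewrite eab; apply: sparse_setU1 => // W tW; apply/negP=> abW; apply: nt.
    by exists W; rewrite ?eab.
  have := maxB (e |: B); rewrite /P subUset sub1set eE sBE (introT (sparseP _) spe).
  by rewrite /= cardsU1 neB ltnn => /(_ isT).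
have := spB setT; rewrite induced_setT cardsT card_ord => /(_ n2).
rewrite leq_eqVlt => /orP[/eqP cB|ltB].
  suff <- : B = E by exact: sparse_laman.
  apply/eqP; rewrite eqEsubset sBE; apply/subsetP=> e eE; apply: contraT => neB.
  case: (minE e eE); apply: generically_rigid_sub (sparse_generically_rigid simB spB cB).
  by rewrite subsetD1 sBE.
have [||u [v [nuv uvB spL]]] := @exists_sparse_setU1 _ B _ simB spB; rewrite ?card_ord //.
have [p gen] := exists_generic_config R n.
by case: (flexible simB sBE nuv uvB spL EB gen); exact: rigE.
Qed.

End GenericRigidity.

Theorem theorem4p7 (R : realType) (n : nat) (E : {set {set 'I_n}}) :
  (2 <= n)%N -> simple_graph E ->
  [<-> laman E;
       henneberg_graph E;
       exists t1 t2 : btree 'I_n,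
         [/\ binary_tree_on t1, binary_tree_on t2 & clade_graph_is_tree E t1 t2];
       generically_minimally_rigid R E].
Proof.
move=> n2 simE; tfae.
- move=> /(laman_sparse n2)[spE cE]; apply: sparse_henneberg; by rewrite ?cardsT ?card_ord.
- exact: henneberg_trees.
- move=> [t1 [t2 [b1 b2 tree]]]; apply: laman_minimally_rigid => //.
  exact: trees_laman tree.
exact: minimally_rigid_laman.
Qed.
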